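(* Let $(t_j,\xi_j)_{j=1}^4$ be four distinct points in $\mathbb{R}^2$ which form a $(1,3)$ configuration or a $(2,2)$ configuration. Let $f:\mathbb{R}\to\mathbb{C}$ be a Schwartz function which is not identically zero. Then there are no complex numbers $d_1,d_2,d_3,d_4$, not all zero, such that $$\sum_{j=1}^4 d_j f(x+t_j)e^{2\pi i\xi_j x}=0\quad\text{for a.e. }x\in\mathbb{R}.$$
   Context: An $(n,m)$ configuration is a collection of $n+m$ distinct points in the plane for which there exist two distinct parallel lines such that one of the lines contains exactly $n$ of the points and the other one contains exactly $m$ of the points. *)

(* Defs.v *)
From HB Require Import structures.
From mathcomp Require Export all_boot all_order all_algebra.
From mathcomp Require Export complex.
From mathcomp Require Export all_classical all_reals all_analysis.
Export Order.TTheory GRing.Theory Num.Theory.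
Export numFieldNormedType.Exports.

Set Implicit Arguments.
Unset Strict Implicit.
Unset Printing Implicit Defensive.

Local Open Scope classical_set_scope.
Local Open Scope ring_scope.

Section Configurations.
Variable R : realType.

(* The affine line through [a] with direction [v]; a line only if [v != 0]. *)
Definition line (a v : R * R) : set (R * R) :=
  [set q | exists s : R, q = (a.1 + s * v.1, a.2 + s * v.2)].

(* Two lines are parallel when they share a direction vector [v]. *)
Definition is_configuration (n m : nat) (I : finType) (p : I -> R * R) : Prop :=
  [/\ injective p,
      #|I| = (n + m)%N
    & exists a b v : R * R,
      [/\ v <> (0, 0),
          line a v <> line b v,
          #|[pred i | p i \in line a v]| = n
        & #|[pred i | p i \in line b v]| = m]].

End Configurations.

Section Schwartz.
Variable R : realType.
Local Open Scope complex_scope.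

(* [R[i]] carries no normed [R]-module structure in the library, so
   differentiation of [f : R -> R[i]] is taken on real and imaginary parts. *)
Definition re_part (f : R -> R[i]) : R -> R := fun x => complex.Re (f x).
Definition im_part (f : R -> R[i]) : R -> R := fun x => complex.Im (f x).

Definition smooth (f : R -> R[i]) : Prop :=
  forall (k : nat) (x : R),
    derivable (derive1n k (re_part f)) x 1 /\ derivable (derive1n k (im_part f)) x 1.

Definition cderive1n (k : nat) (f : R -> R[i]) (x : R) : R[i] :=
  derive1n k (re_part f) x +i* derive1n k (im_part f) x.

(* [`|z|] on [R[i]] is the modulus as an element of [R[i]]; both sides of the
   inequality are real, so this is the usual order on [R]. *)
Definition schwartz (f : R -> R[i]) : Prop :=
  smooth f /\
  forall n k : nat, exists M : R,
    forall x : R, `|x%:C ^+ n * cderive1n k f x| <= M%:C.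

Definition cis (theta : R) : R[i] := cos theta +i* sin theta.

End Schwartz.

(* Main.v *)
Require Import Defs.
From mathcomp Require Import ring lra zify.
Set Implicit Arguments.
Unset Strict Implicit.
Unset Printing Implicit Defensive.
Import Normc.

(** Let [f] be a Schwartz function satisfying a relation of the stated kind.

    The four points lie on two parallel lines, and the first step makes these
    lines vertical.  If they are not, multiply [f] by the quadratic chirp
    [e1 (sg * x ^+ 2)], where [2 * sg] is their slope, and take the Fourier
    transform: this maps the relation to a relation of the same kind between
    points on two vertical lines ([two_lines_independent]), and the new
    function is again continuous, rapidly decaying and non-zero
    ([chirp_transform]; that it is non-zero is [transform_injective]).

    When the lines are vertical only two translates of the function occur, so
    after a change of variable the relation is a recurrence of step 1 for
    its modulus [g], namely [g (x + 1) * D x = g x * N x], where [D] and [N]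
    are moduli of trigonometric polynomials.  In both kinds of configuration
    one can write [N y] as the modulus of [A y + c * e1 (be * y)] with [A] and
    [D] periodic of the same period [L]; this is where the shape (1,3) or (2,2)
    is used ([vertical_lines_independent]).

    The recurrence has no non-zero rapidly decaying solution
    ([rapidly_decaying_solution_eq0]).  Let [T] be a multiple of [L] for
    which [e1 (be * T)] is very close to 1 and which is also close to an
    integer [n].  Running the recurrence [n] times from [x] and from [x - T]
    and dividing gives, up to the distortion [prod N (x + k - T) / N (x + k)],
    [g (x + n) * g (x - T) = g x * g (x + n - T)].  The right-hand side is
    bounded below since [n - T] is small, while [g (x + n)] is smaller than
    any power of [T].  It remains to find [x] in a fixed window for which the
    distortion is at most a power of [T].

    Its logarithm is a sum over [k < n] of terms of size [delta / N (x + k)],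
    where [delta] measures how far [e1 (be * T)] is from 1.  Averaging over [x]
    and regrouping the line into periods of length [L] reduces this to sums
    over [i < q] of [delta / |A + c * e1 (ph + i * ga)|] with [A] fixed.  If [q]
    is a best approximation denominator of [ga = be * L], the points
    [c * e1 (ph + i * ga)] are [delta]-separated on a circle, so that all but
    the closest one contribute a harmonic sum, [O(log q)]
    ([sum_log_near_circle_le]).  The closest one contributes [O(log q)] as
    soon as [N (x + k)] is at least a negative power of [q] for all [k]; this
    excludes few points of the window because the sublevel sets of a sum of
    three exponentials are thin ([three_exponentials_thin]).  All averages are
    computed with explicit antiderivatives and the mean value theorem
    ([avoiding_mean_value]). *)

Local Open Scope classical_set_scope.
Local Open Scope ring_scope.
Local Open Scope complex_scope.

(** * The modulus of a complex number *)

Section Modulus.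
Variable R : realType.
Implicit Types (z w : R[i]) (x y t u : R).

Lemma normc_ge0 z : 0 <= normc z.
Proof. by case: z => a b; exact: sqrtr_ge0. Qed.

Lemma normcD_le z w : normc (z + w) <= normc z + normc w.
Proof. exact: (@le_normcD R z w). Qed.

Lemma normc_opp z : normc (- z) = normc z.
Proof. exact: (@normcN R z). Qed.

Lemma normc_sub z w : normc (z - w) = normc (w - z).
Proof. by rewrite -normc_opp opprB. Qed.

Lemma normcB_le z w : normc (z - w) <= normc z + normc w.
Proof. by rewrite -(normc_opp w) normcD_le. Qed.

Lemma normcB_tri z w v : normc (z - w) <= normc (z - v) + normc (v - w).
Proof. by have := normcD_le (z - v) (v - w); rewrite addrA subrK. Qed.

Lemma normc_eq0 z : (normc z == 0) = (z == 0).
Proof.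
by apply/eqP/eqP => [/eq0_normc //|->]; rewrite normc0.
Qed.

Lemma normc_gt0 z : (0 < normc z) = (z != 0).
Proof. by rewrite lt_def normc_ge0 normc_eq0 andbT. Qed.

Lemma normc_real x : normc x%:C = `|x|.
Proof. by rewrite /= expr0n addr0 sqrtr_sqr. Qed.

Lemma normc_Re_le z : `|complex.Re z| <= normc z.
Proof.
case: z => a b /=; rewrite -[leLHS]sqrtr_sqr ler_sqrt ?addr_ge0 ?sqr_ge0//.
by rewrite lerDl sqr_ge0.
Qed.

Lemma normc_Im_le z : `|complex.Im z| <= normc z.
Proof.
case: z => a b /=; rewrite -[leLHS]sqrtr_sqr ler_sqrt ?addr_ge0 ?sqr_ge0//.
by rewrite lerDr sqr_ge0.
Qed.

Lemma normc_le_ReIm z : normc z <= `|complex.Re z| + `|complex.Im z|.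
Proof.
case: z => a b /=; rewrite -[leRHS]ger0_norm ?addr_ge0// -sqrtr_sqr.
rewrite ler_sqrt ?sqr_ge0// sqrrD !real_normK ?num_real//.
by rewrite -addrA lerD2l lerDr mulrn_wge0// mulr_ge0.
Qed.

Lemma normc_sqr z : normc z ^+ 2 = complex.Re z ^+ 2 + complex.Im z ^+ 2.
Proof. by case: z => a b /=; rewrite sqr_sqrtr ?addr_ge0 ?sqr_ge0. Qed.

End Modulus.

Section MeanValue.
Variable R : realType.

Lemma eq_ler (x y : R) : x = y -> x <= y.
Proof. by move=> ->. Qed.

Lemma mean_value (f df : R -> R) (a b : R) : a <= b ->
  (forall x : R, a <= x <= b -> is_derive x 1 f (df x)) ->
  exists2 c, a <= c <= b & f b - f a = df c * (b - a).
Proof.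
move=> ab h.
have cf : {within `[a, b], continuous f}.
  apply: continuous_in_subspaceT => x; rewrite inE /= in_itv /= => xab.
  apply: differentiable_continuous; apply/derivable1_diffP.
  by case: (h x xab).
have df' x : x \in `]a, b[ -> is_derive x 1 f (df x).
  by rewrite in_itv /= => /andP[ax xb]; apply: h; rewrite !ltW.
have [c + fc] := MVT_segment ab df' cf; rewrite in_itv => abc.
by exists c.
Qed.

End MeanValue.

(** * The character of the circle and chordal distance *)

Section Character.
Variable R : realType.
Implicit Types (x y t u : R).

(** The exponential of [2 * pi * 'i * t], a character of period 1. *)
Definition e1 (t : R) : R[i] := cis (2 * pi * t).

Lemma e1D t u : e1 (t + u) = e1 t * e1 u.
Proof.
rewrite /e1 mulrDr /cis cosD sinD.
by apply/eqP; rewrite eq_complex /=; apply/andP; split; apply/eqP => //; ring.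
Qed.

Lemma e10 : e1 0 = 1.
Proof. by rewrite /e1 mulr0 /cis cos0 sin0. Qed.

Lemma normc_e1 t : normc (e1 t) = 1.
Proof. by rewrite /= cos2Dsin2 sqrtr1. Qed.

Lemma e1_neq0 t : e1 t != 0.
Proof. by rewrite -normc_eq0 normc_e1 oner_eq0. Qed.

Lemma e1VN t : e1 t * e1 (- t) = 1.
Proof. by rewrite -e1D subrr e10. Qed.

Lemma e1_1 : e1 1 = 1.
Proof.
by rewrite /e1 mulr1 /cis mulrC mulr_natr cos2pi sin2pi.
Qed.

Lemma e1_nat (n : nat) : e1 n%:R = 1.
Proof.
elim: n => [|n IH]; first exact: e10.
by rewrite -addn1 natrD e1D IH e1_1 mulr1.
Qed.

Lemma e1_int (k : int) : e1 k%:~R = 1.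
Proof.
case: k => n; first exact: e1_nat.
rewrite NegzE mulrNz; have := e1VN (n.+1%:R); rewrite e1_nat mul1r; exact.
Qed.

(** Distance to the integers, measured by the chord it spans on the circle;
    it is comparable with the usual distance but subadditive for free. *)
Definition chord (t : R) : R := normc (e1 t - 1).

Lemma chord_ge0 t : 0 <= chord t.
Proof. exact: normc_ge0. Qed.

Lemma chord_e1B t u : normc (e1 t - e1 u) = chord (t - u).
Proof.
rewrite /chord; have -> : e1 t - e1 u = (e1 (t - u) - 1) * e1 u.
  by rewrite mulrBl mul1r -e1D subrK.
by rewrite normcM normc_e1 mulr1.
Qed.

Lemma chordN t : chord (- t) = chord t.
Proof. by rewrite -[t in RHS]subr0 -chord_e1B normc_sub chord_e1B sub0r. Qed.

Lemma chordD t u : chord (t + u) <= chord t + chord u.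
Proof.
rewrite -[u in leLHS]opprK -chord_e1B.
apply: le_trans (normcB_tri _ _ 1) _.
by rewrite (normc_sub 1) -!/(chord _) chordN.
Qed.

Lemma chordMn (n : nat) t : chord (n%:R * t) <= n%:R * chord t.
Proof.
elim: n => [|n IH]; first by rewrite !mul0r /chord e10 subrr normc0.
by rewrite -addn1 natrD !mulrDl !mul1r (le_trans (chordD _ _))// lerD2r.
Qed.

Lemma chord_int t (k : int) : chord (t - k%:~R) = chord t.
Proof. by rewrite /chord e1D -mulrNz e1_int mulr1. Qed.

Lemma chordE t : chord t = 2 * `|sin (pi * t)|.
Proof.
apply: (@pexpIrn _ 2) => //; rewrite ?nnegrE ?chord_ge0 ?mulr_ge0//.
rewrite normc_sqr /= exprMn real_normK ?num_real// subr0.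
have -> : 2 * pi * t = (pi * t) *+ 2 by rewrite -mulr_natl; ring.
rewrite cos_mulr2n sin_mulr2n !mulr2n.
have := cos2Dsin2 (pi * t); set c := cos _; set s := sin _ => h.
have -> : c ^+ 2 = 1 - s ^+ 2 by rewrite -h addrK.
have -> : (c * s + c * s) ^+ 2 = 4 * c ^+ 2 * s ^+ 2 by ring.
have -> : c ^+ 2 = 1 - s ^+ 2 by rewrite -h addrK.
ring.
Qed.

Lemma norm_sin_le x : `|sin x| <= `|x|.
Proof.
wlog x0 : x / 0 <= x => [hw|].
  have [/hw //|/ltW x0] := leP 0 x.
  by rewrite -(normrN x) -(normrN (sin x)) -sinN; apply: hw; rewrite oppr_ge0.
rewrite (ger0_norm x0).
have [c _] := mean_value x0 (fun s _ => is_derive_sin s).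
rewrite sin0 !subr0 => ->; rewrite normrM (ger0_norm x0) -[leRHS]mul1r.
by rewrite ler_wpM2r// cos_max.
Qed.

Lemma norm_sin_ge x : `|x| <= pi / 2 -> `|x| / 2 <= `|sin x|.
Proof.
wlog x0 : x / 0 <= x => [hw|].
  have [/hw //|/ltW x0] := leP 0 x.
  by rewrite -(normrN x) -(normrN (sin x)) -sinN; apply: hw; rewrite oppr_ge0.
rewrite (ger0_norm x0) => xpi.
have p2 := pi_ge2 R.
rewrite (@ger0_norm _ (sin x)); last by apply: sin_ge0_pi; lra.
(* halve the angle: sin x = 2 sin y cos y, and cos ^+ 2 >= 1/2 on [0, y] *)
have [y yE] : exists y, y = x / 2 by exists (x / 2).
have xy : x = y *+ 2 by rewrite -mulr_natl yE; lra.
have y0 : 0 <= y by lra.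
have cy s : 0 <= s <= y -> 0 <= cos s /\ 1 / 2 <= cos s ^+ 2.
  move=> /andP[s0 sy].
  have c2 : 0 <= cos (s *+ 2).
    by apply: cos_ge0_pihalf; rewrite -mulr_natl; lra.
  have c0 : 0 <= cos s.
    by apply: cos_ge0_pihalf; lra.
  by rewrite cos_mulr2n in c2; split => //; lra.
have [c cin] := mean_value y0 (fun s _ => is_derive_sin s).
rewrite sin0 !subr0 => siny.
have [cc0 cc] := cy c cin.
have [cy0 cy2] : 0 <= cos y /\ 1 / 2 <= cos y ^+ 2 by apply: cy; rewrite y0 lexx.
rewrite xy sin_mulr2n siny.
have : 1 / 2 <= cos y * cos c.
  rewrite leNgt; apply/negP => lt2.
  have : (cos y * cos c) ^+ 2 < (1 / 2) ^+ 2.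
    by rewrite ltrXn2r// ?nnegrE ?mulr_ge0//; lra.
  have : (1 / 2) * (1 / 2) <= cos y ^+ 2 * cos c ^+ 2 by apply: ler_pM => //; lra.
  by rewrite exprMn; lra.
move=> /(ler_wpM2r y0); rewrite !mulr2n mulrA.
by move: (cos y * cos c * y) => p; lra.
Qed.

Lemma chord_le t : chord t <= 2 * pi * `|t|.
Proof.
rewrite chordE -mulrA ler_wpM2l// (le_trans (norm_sin_le _))//.
by rewrite normrM ger0_norm ?pi_ge0.
Qed.

Lemma chord_ge t : `|t| <= 1 / 2 -> 2 * `|t| <= chord t.
Proof.
move=> ht; rewrite chordE; have p2 := pi_ge2 R.
have : `|pi * t| / 2 <= `|sin (pi * t)|.
  apply: norm_sin_ge; rewrite normrM ger0_norm ?pi_ge0//.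
  by rewrite ler_wpM2l// ?pi_ge0//; lra.
rewrite normrM (ger0_norm (pi_ge0 R)).
have : 2 * `|t| <= pi * `|t| by rewrite ler_wpM2r.
lra.
Qed.

Lemma near_int t : exists k : int, `|t - k%:~R| <= 1 / 2.
Proof.
exists (Num.floor (t + 1 / 2)); rewrite ler_norml.
have := floor_le (t + 1 / 2).
have /andP[_] := floor_itv (t + 1 / 2); rewrite intrD; lra.
Qed.

End Character.

(** * Best approximation on the circle *)

Section Diophantine.
Variable R : realType.
Implicit Types (x y t u : R).

(** Pigeonhole: [M + 1] multiples of [t] fall into [M] cells of the circle. *)
Lemma dirichlet (M : nat) t : (0 < M)%N ->
  exists m : nat, [/\ (0 < m)%N, (m <= M)%N
    & exists n : int, `|m%:R * t - n%:~R| <= M%:R^-1].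
Proof.
move=> M0; have M0R : 0 < M%:R :> R by rewrite ltr0n.
pose fr (i : nat) : R := i%:R * t - (Num.floor (i%:R * t))%:~R.
have fr01 i : 0 <= fr i < 1.
  have := floor_itv (i%:R * t); rewrite intrD /fr.
  by move=> /andP[h1 h2]; apply/andP; split; lra.
have cellP (i : 'I_M.+1) : (Num.trunc (M%:R * fr i) < M)%N.
  have /andP[f0 f1] := fr01 i.
  have h0 : 0 <= M%:R * fr i by rewrite mulr_ge0// ltW.
  have /andP[h1 h2] := truncn_itv h0.
  by rewrite -(ltr_nat R); apply: le_lt_trans h1 _; rewrite -[ltRHS]mulr1 ltr_pM2l.
pose cell (i : 'I_M.+1) := Ordinal (cellP i).
have /injectivePn[i [j ij cij]] : ~~ injectiveb cell.
  apply/negP => /injectiveP/leq_card; rewrite !card_ord; by rewrite ltnn.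
wlog lij : i j ij cij / (i < j)%N.
  move=> hw; move: (ij); rewrite -val_eqE /= neq_ltn => /orP[|] h.
    exact: (hw i j).
  by apply: (hw j i) => //; rewrite eq_sym.
exists (j - i)%N; split; first by rewrite subn_gt0.
  by rewrite (leq_trans (leq_subr _ _))// -ltnS.
exists (Num.floor (j%:R * t) - Num.floor (i%:R * t)).
have -> : (j - i)%:R * t - (Num.floor (j%:R * t) - Num.floor (i%:R * t))%:~R
   = fr j - fr i.
  by rewrite natrB ?(ltnW lij)// intrB /fr; ring.
have cE : Num.trunc (M%:R * fr i) = Num.trunc (M%:R * fr j) by case: cij.
have hi : 0 <= M%:R * fr i by rewrite mulr_ge0 ?(ltW M0R)//; case/andP: (fr01 i).
have hj : 0 <= M%:R * fr j by rewrite mulr_ge0 ?(ltW M0R)//; case/andP: (fr01 j).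
have /andP[i1 i2] := truncn_itv hi; have /andP[j1 j2] := truncn_itv hj.
rewrite cE -natr1 in i1 i2; rewrite -natr1 in j2.
rewrite -(ler_pM2l M0R) divff ?gt_eqF// -[X in X * _](ger0_norm (ltW M0R)).
rewrite -normrM mulrBr ler_norml; apply/andP; split; lra.
Qed.

(** Being closer to the integers than all smaller multiples is what makes the
    orbit of the rotation by [ga] separated at the scale of its own return.
    If [ga] is rational, the multiples of its denominator qualify, with an exact
    return. *)
Lemma best_denominators (ga : R) (Q : nat) :
  exists q : nat, [/\ (Q <= q)%N, (0 < q)%N &
    forall i : nat, (0 < i)%N -> (i < q)%N ->
      chord (q%:R * ga) <= chord (i%:R * ga)].
Proof.
have [[i [i0 ci]]|nz] := pselect (exists i : nat, (0 < i)%N /\ chord (i%:R * ga) = 0).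
  exists (Q.+1 * i)%N; split; first by rewrite (leq_trans (leqnSn Q))// leq_pmulr.
    by rewrite muln_gt0.
  move=> j _ _; rewrite (@le_trans _ _ 0) ?chord_ge0//.
  have := chordMn Q.+1 (i%:R * ga); rewrite ci mulr0 mulrA -natrM.
  by move=> h; rewrite h.
have pos i : (0 < i)%N -> 0 < chord (i%:R * ga).
  move=> i0; rewrite lt_def chord_ge0 andbT.
  by apply/eqP => ci; apply: nz; exists i.
have [mu mu0 muP] : exists2 mu : R, 0 < mu &
    forall i, (0 < i)%N -> (i < Q)%N -> mu <= chord (i%:R * ga).
  elim: Q => [|Q [mu mu0 IH]]; first by exists 1.
  have [->|Q0] := eqVneq Q 0%N.
    by exists 1 => // i i0; rewrite ltnS leqNgt i0.
  rewrite -lt0n in Q0; exists (Num.min mu (chord (Q%:R * ga))).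
    by rewrite lt_min mu0 pos.
  move=> i i0; rewrite ltnS leq_eqVlt => /orP[/eqP ->|iQ].
    by rewrite ge_min lexx orbT.
  by rewrite ge_min IH.
have ex : exists q : nat, (0 < q)%N && (chord (q%:R * ga) < mu).
  have p0 := pi_gt0 R.
  pose M := (Num.trunc (2 * pi / mu)).+1.
  have [m [m0 _ [n hn]]] := dirichlet ga (isT : (0 < M)%N).
  exists m; rewrite m0 -(chord_int _ n) (le_lt_trans (chord_le _))//.
  apply: (@le_lt_trans _ _ (2 * pi * M%:R^-1)).
    by rewrite ler_wpM2l// mulr_ge0// ltW.
  have h : 0 <= 2 * pi / mu by rewrite divr_ge0 ?mulr_ge0// ltW.
  have /andP[_ h2] := truncn_itv h.
  by move: h2; rewrite ltr_pdivrMr// ltr_pdivrMr ?ltr0n// [mu * _]mulrC.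
pose q := ex_minn ex; exists q; rewrite /q.
case: ex_minnP => {}q /andP[q0 cq] qmin; split => //.
  rewrite leqNgt; apply/negP => /(muP _ q0); rewrite leNgt cq//.
move=> i i0 iq; rewrite leNgt; apply/negP => ci.
have := qmin i; rewrite i0 (lt_trans ci cq) => /(_ isT).
by rewrite leqNgt iq.
Qed.

Definition harmonic_sum (q : nat) : R := \sum_(j < q) j.+1%:R^-1.

Lemma harmonic_sum_le (q : nat) : (0 < q)%N -> harmonic_sum q <= 1 + ln q%:R.
Proof.
case: q => // q _; elim: q => [|q IH].
  by rewrite /harmonic_sum big_ord1 ln1 invr1 addr0.
rewrite /harmonic_sum big_ord_recr /= -/(harmonic_sum q.+1).
have h : ln (1 + - q.+2%:R^-1) <= - q.+2%:R^-1 :> R.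
  by rewrite le_ln1Dx// ltrN2 invf_lt1 ?ltr0n// ltr1n.
have e : (1 : R) + - q.+2%:R^-1 = q.+1%:R / q.+2%:R.
  have : q.+2%:R != 0 :> R by rewrite pnatr_eq0.
  by move=> n0; rewrite -[q.+1%:R](addrK 1) natr1 mulrBl divff// mul1r.
rewrite e ln_div ?posrE ?ltr0n// in h.
move: IH h; move: (harmonic_sum _) (ln _) (ln q.+2%:R) (q.+2%:R^-1) => a b c d.
lra.
Qed.

(** An injection takes each absolute value below [q] at most twice, and the
    remaining terms, at most [q] of them, are at most [q^-1] each. *)
Lemma sum_injective_le (q : nat) (P : pred 'I_q) (s : 'I_q -> int) :
  {in P &, injective s} ->
  \sum_(i < q | P i) (`|s i|%N.+1)%:R^-1 <= 2 * harmonic_sum q + 1 :> R.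
Proof.
move=> sinj.
have [q0|q0] := posnP q.
  rewrite /harmonic_sum; move: P s sinj; rewrite q0 => P s _.
  by rewrite big1 => [|[]//]; rewrite big_ord0 mulr0 add0r.
have le1 (a : nat) : (a.+1)%:R^-1 <=
    \sum_(j < q) (if (j : nat) == a then j.+1%:R^-1 else 0) + q%:R^-1 :> R.
  have [aq|qa] := ltnP a q.
    rewrite (bigD1 (Ordinal aq)) //= eqxx -addrA lerDl addr_ge0 ?invr_ge0//.
    by apply: sumr_ge0 => j _; case: ifP.
  rewrite ler_wpDl//; first by apply: sumr_ge0 => j _; case: ifP.
  by rewrite lef_pV2 ?posrE ?ltr0n// ler_nat leqW.
apply: le_trans (ler_sum _ (fun i _ => le1 `|s i|%N)) _.
rewrite big_split /= exchange_big /= /harmonic_sum mulr_sumr.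
apply: lerD; last first.
  rewrite sumr_const -[leLHS]mulr_natl ler_pdivrMr ?ltr0n// mul1r ler_nat.
  by rewrite (leq_trans (max_card _))// card_ord.
apply: ler_sum => j _; rewrite -big_mkcondr /= sumr_const -[leLHS]mulr_natl.
rewrite ler_wpM2r ?invr_ge0// ler_nat.
rewrite -(size_image s) (@leq_trans (size [:: (j : nat)%:Z; - (j : nat)%:Z]))//.
apply: uniq_leq_size.
  rewrite map_inj_in_uniq ?enum_uniq// => x y.
  rewrite !mem_enum => /andP[Px _] /andP[Py _]; exact: sinj.
move=> z /mapP[x]; rewrite mem_enum => /andP[_ /eqP jx] ->; rewrite jx !inE; lia.
Qed.

(** The points [i * ga] are separated by [chord (q * ga)] on the circle, so
    rounding their angles to multiples of an eighth of it is injective, and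
    the reciprocal distances to one of them sum like the harmonic series. *)
Lemma sum_chord_le (ga : R) (q : nat) (i0 : 'I_q) :
  0 < chord (q%:R * ga) ->
  (forall i : nat, (0 < i)%N -> (i < q)%N ->
      chord (q%:R * ga) <= chord (i%:R * ga)) ->
  \sum_(i < q | i != i0) chord (q%:R * ga) / chord ((i%:R - i0%:R) * ga)
    <= 6 * (2 * harmonic_sum q + 1).
Proof.
set de := chord (q%:R * ga) => de0 rec.
have sep (i j : 'I_q) : i != j -> de <= chord ((i%:R - j%:R) * ga).
  wlog lij : i j / (j < i)%N => [hw ij|ij].
    move: (ij); rewrite -val_eqE /= neq_ltn => /orP[|] h; last exact: hw.
    by rewrite -chordN -mulNr opprB; apply: hw => //; rewrite eq_sym.
  rewrite -natrB ?(ltnW lij)//; apply: rec; first by rewrite subn_gt0.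
  by rewrite (leq_ltn_trans (leq_subr _ _))// ltn_ord.
pose k (i : 'I_q) := projT1 (cid (near_int ((i%:R - i0%:R) * ga))).
pose r (i : 'I_q) : R := (i%:R - i0%:R) * ga - (k i)%:~R.
have rP i : `|r i| <= 1 / 2 by rewrite /r /k; case: cid.
have rc i : chord (r i) = chord ((i%:R - i0%:R) * ga) by rewrite chord_int.
have pi4 : pi < 4 :> R by have /andP[_] := pihalf_02 R; lra.
pose s (i : 'I_q) := Num.floor (8 * r i / de).
have sinj : {in [pred i | i != i0] &, injective s}.
  move=> i j _ _ sij; apply/eqP; apply/negPn/negP => ij.
  have := sep _ _ ij.
  have -> : chord ((i%:R - j%:R) * ga) = chord (r i - r j).
    rewrite -[RHS](chord_int _ (- (k i - k j))); congr chord.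
    by rewrite /r intrN intrB; ring.
  apply/negP; rewrite -ltNge (le_lt_trans (chord_le _))//.
  have : `|8 * r i / de - 8 * r j / de| < 1.
    have /andP[a1 a2] := floor_itv (8 * r i / de).
    have /andP[b1 b2] := floor_itv (8 * r j / de).
    rewrite -/(s i) intrD in a1 a2; rewrite -/(s j) -sij intrD in b1 b2.
    by rewrite ltr_norml; apply/andP; split; lra.
  rewrite -mulrBl -mulrBr normrM normfV (gtr0_norm de0) ltr_pdivrMr// mul1r.
  rewrite normrM ger0_norm// => h.
  apply: le_lt_trans h; rewrite ler_wpM2r//; lra.
apply: le_trans (ler_wpM2l _ (sum_injective_le sinj)) => //.
rewrite mulr_sumr; apply: ler_sum => i ii0.
rewrite -rc; have h := chord_ge (rP i); have h' := chord_le (r i).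
have hd := sep _ _ ii0; rewrite -rc in hd.
have cr0 : 0 < chord (r i) by exact: lt_le_trans hd.
have r8 : `|r i| * 8 >= de.
  have : 2 * pi * `|r i| <= 8 * `|r i| by rewrite ler_wpM2r//; lra.
  lra.
have absz_le : (`|s i|%N.+1)%:R <= `|8 * r i / de| + 2.
  rewrite -natr1 natr_absz intr_norm.
  have /andP[a1 a2] := floor_itv (8 * r i / de).
  rewrite -/(s i) intrD in a1 a2.
  have h8 := ler_norm (8 * r i / de); have := ler_norm (- (8 * r i / de)).
  rewrite normrN => h9.
  have : `|(s i)%:~R| <= `|8 * r i / de| + 1.
    by rewrite ler_norml; apply/andP; split; lra.
  lra.
rewrite normrM normfV (gtr0_norm de0) normrM (@ger0_norm _ 8)// in absz_le.
rewrite ler_pdivlMr ?ltr0n// mulrAC ler_pdivrMr// mulrC.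
have := ler_wpM2r (ltW de0) absz_le.
rewrite mulrDl divfK ?gt_eqF//; lra.
Qed.

End Diophantine.

(** * Distortion over one block of periods *)

Section Block.
Variable R : realType.

(** Among the points [- c * e1 (ph + i * ga)] only the one closest to [A] can be
    really close to it: by the triangle inequality, [A] is at least half as far
    from any other one as the two points are from each other.  The cut-off
    [ep] serves for the closest point alone. *)
Lemma sum_log_near_circle_le (A c : R[i]) (ph ga K ep : R) (q : nat) :
  c != 0 -> 0 <= K -> 0 < ep -> (0 < q)%N ->
  (forall i : nat, (0 < i)%N -> (i < q)%N ->
      chord (q%:R * ga) <= chord (i%:R * ga)) ->
  \sum_(i < q) ln (1 + K * chord (q%:R * ga) /
                        (normc (A + c * e1 (ph + i%:R * ga)) + ep))
   <= ln (1 + 2 * K / ep) + 12 * K / normc c * (2 * harmonic_sum R q + 1).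
Proof.
move=> c0 K0 ep0 q0 rec.
have nc0 : 0 < normc c by rewrite normc_gt0.
set de := chord (q%:R * ga).
pose N (i : 'I_q) := normc (A + c * e1 (ph + i%:R * ga)).
have N0 i : 0 <= N i by exact: normc_ge0.
have Ne i : 0 < N i + ep by rewrite ltr_wpDl.
have de_ge0 : 0 <= de by exact: chord_ge0.
have de_le2 : de <= 2.
  rewrite /de /chord (le_trans (normcB_le _ _))// normc_e1 normc1; lra.
have H0 : 0 <= harmonic_sum R q by apply: sumr_ge0 => i _; rewrite invr_ge0.
have rhs0 : 0 <= 12 * K / normc c * (2 * harmonic_sum R q + 1).
  by rewrite mulr_ge0// ?divr_ge0 ?mulr_ge0//; lra.
have [i0 _ i0min] := @Order.TotalTheory.arg_minP _ _ _ (Ordinal q0) predT N isT.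
have near_le : ln (1 + K * de / (N i0 + ep)) <= ln (1 + 2 * K / ep).
  have e1' : 0 <= K * de / (N i0 + ep) by rewrite divr_ge0 ?mulr_ge0// ltW.
  have e2 : 0 <= 2 * K / ep by rewrite divr_ge0 ?mulr_ge0// ltW.
  rewrite ler_ln ?posrE; [|lra|lra].
  rewrite lerD2l ler_pM ?mulr_ge0// ?invr_ge0 ?(ltW (Ne _))//.
    by rewrite mulrC ler_wpM2r.
  by rewrite lef_pV2 ?posrE// lerDr.
rewrite (bigD1 i0)//= lerD//.
have [de0|de0] := eqVneq de 0.
  by rewrite big1// => i _; rewrite de0 mulr0 mul0r addr0 ln1.
have {de0} de0 : 0 < de by rewrite lt_def de0.
apply: (@le_trans _ _ (2 * K / normc c *
    \sum_(i < q | i != i0) de / chord ((i%:R - i0%:R) * ga))); last first.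
  apply: (@le_trans _ _ (2 * K / normc c * (6 * (2 * harmonic_sum R q + 1)))).
    apply: ler_wpM2l; first by rewrite divr_ge0 ?mulr_ge0// ltW.
    exact: sum_chord_le.
  by apply: eq_ler; ring.
rewrite mulr_sumr; apply: ler_sum => i ii0.
have dist : normc c * chord ((i%:R - i0%:R) * ga) <= 2 * N i.
  have -> : normc c * chord ((i%:R - i0%:R) * ga) =
      normc ((A + c * e1 (ph + i%:R * ga)) - (A + c * e1 (ph + i0%:R * ga))).
    have -> : (i%:R - i0%:R) * ga = (ph + i%:R * ga) - (ph + i0%:R * ga) by ring.
    by rewrite -chord_e1B -normcM; congr normc; ring.
  apply: le_trans (normcB_le _ _) _; rewrite -/(N i) -/(N i0).
  by have := i0min i isT; lra.
have ch0 : 0 < chord ((i%:R - i0%:R) * ga).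
  apply: lt_le_trans de0 _.
  have [lt|lt] : (i < i0)%N \/ (i0 < i)%N.
    by move: ii0; rewrite -val_eqE /= neq_ltn => /orP[]; [left|right].
  + rewrite -chordN -mulNr opprB -natrB ?(ltnW lt)//; apply: rec.
      by rewrite subn_gt0.
    by rewrite (leq_ltn_trans (leq_subr _ _)).
  + rewrite -natrB ?(ltnW lt)//; apply: rec; first by rewrite subn_gt0.
    by rewrite (leq_ltn_trans (leq_subr _ _)).
have Ni0 : 0 < N i.
  have : 0 < normc c * chord ((i%:R - i0%:R) * ga) by rewrite mulr_gt0.
  lra.
have Kd0 : 0 <= K * de by rewrite mulr_ge0.
rewrite -/(N i); apply: (@le_trans _ _ (K * de / N i)).
  apply: (@le_trans _ _ (K * de / (N i + ep))).
    apply: le_ln1Dx.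
    by rewrite (@lt_le_trans _ _ 0)// ?ltrN10// divr_ge0// ltW.
  by rewrite ler_wpM2l// lef_pV2 ?posrE// lerDl ltW.
rewrite ler_pdivrMr//.
have -> : 2 * K / normc c * (de / chord ((i%:R - i0%:R) * ga)) * N i =
   K * de * (2 * N i / (normc c * chord ((i%:R - i0%:R) * ga))).
  by field; rewrite ?gt_eqF.
rewrite -[leLHS]mulr1 ler_wpM2l// ler_pdivlMr ?mul1r//.
by rewrite mulr_gt0.
Qed.

End Block.

(** * Sublevel sets of sums of three exponentials *)

Section Sublevel.
Variable R : realType.

(** A covering form of a sublevel set estimate: each window loses measure at
    most [4 * si] when the level is [ka * si ^+ 3].  Two points and the exponent
    3 are what a determinant of order 3 yields. *)
Definition thin_sublevels (G : R -> R) : Prop :=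
  exists ka r0 : R, [/\ 0 < ka, 0 < r0 &
    forall si w : R, 0 < si -> exists a b : R, forall y : R,
      w <= y <= w + r0 -> G y < ka * si ^+ 3 -> `|y - a| <= si \/ `|y - b| <= si].

Lemma e1B1 (t : R) : e1 t - 1 = e1 (t / 2) * (0 +i* (2 * sin (pi * t))).
Proof.
have -> : e1 t = e1 (t / 2) * e1 (t / 2) by rewrite -e1D; congr e1; field.
rewrite -[X in _ - X](e1VN (t / 2)) -mulrBr; congr (_ * _).
rewrite /e1 /cis mulrN cosN sinN.
have -> : 2 * pi * (t / 2) = pi * t by field.
by apply/eqP; rewrite eq_complex /=; apply/andP; split; apply/eqP; ring.
Qed.

(** Factoring the half-angle phases out of the four differences leaves, up to a
    phase, [X * e1 u - Y] with [X] and [Y] real, which is at least its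
    imaginary part [X * sin (2 * pi * u)]: a product of three sines. *)
Lemma det_lower_bound (al be s t : R) :
  chord (be * s) * chord (al * t) * chord ((be - al) * (s - t)) / 2 <=
  normc ((e1 (be * s) - 1) * (e1 (al * t) - 1)
       - (e1 (be * t) - 1) * (e1 (al * s) - 1)).
Proof.
rewrite !e1B1.
set X := 4 * sin (pi * (be * s)) * sin (pi * (al * t)).
set Y := 4 * sin (pi * (be * t)) * sin (pi * (al * s)).
set p := (be * s + al * t) / 2; set p' := (be * t + al * s) / 2.
have -> : e1 (be * s / 2) * (0 +i* (2 * sin (pi * (be * s)))) *
   (e1 (al * t / 2) * (0 +i* (2 * sin (pi * (al * t))))) -
   e1 (be * t / 2) * (0 +i* (2 * sin (pi * (be * t)))) *
   (e1 (al * s / 2) * (0 +i* (2 * sin (pi * (al * s))))) =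
   (- e1 p') * (X%:C * e1 (p - p') - Y%:C).
  have -> : (- e1 p') * (X%:C * e1 (p - p') - Y%:C) =
     - X%:C * (e1 p' * e1 (p - p')) + Y%:C * e1 p' by ring.
  rewrite -e1D [p' + _]addrC subrK.
  have -> : e1 p = e1 (be * s / 2) * e1 (al * t / 2).
    by rewrite -e1D; congr e1; rewrite /p; field.
  have -> : e1 p' = e1 (be * t / 2) * e1 (al * s / 2).
    by rewrite -e1D; congr e1; rewrite /p'; field.
  have im (u v : R) : (0 +i* (2 * u)) * (0 +i* (2 * v)) = - (4 * u * v)%:C.
    by apply/eqP; rewrite eq_complex /=; apply/andP; split; apply/eqP; ring.
  rewrite mulrACA im [X in _ - X]mulrACA im -/X -/Y; ring.
rewrite normcM normc_opp normc_e1 mul1r.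
apply: le_trans (normc_Im_le _).
have -> : complex.Im (X%:C * e1 (p - p') - Y%:C) =
    X * sin (pi * ((be - al) * (s - t))).
  have -> : pi * ((be - al) * (s - t)) = 2 * pi * (p - p') by rewrite /p /p'; field.
  by rewrite /= mul0r addr0 subr0.
rewrite !chordE /X !normrM (@ger0_norm _ 4)//.
by apply: eq_ler; field.
Qed.

(** If the sum were small at three points far apart, eliminating [c0] and [c1]
    would make [c2] times a determinant small, against [det_lower_bound]. *)
Lemma three_exponentials_thin (c0 c1 c2 : R[i]) (l0 l1 l2 : R) :
  l0 != l1 -> l0 != l2 -> l1 != l2 -> c2 != 0 ->
  thin_sublevels (fun y => normc (c0 * e1 (l0 * y) + c1 * e1 (l1 * y) + c2 * e1 (l2 * y))).
Proof.
move=> h01 h02 h12 nz2.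
pose al := l1 - l0; pose be := l2 - l0.
have al0 : al != 0 by rewrite subr_eq0 eq_sym.
have be0 : be != 0 by rewrite subr_eq0 eq_sym.
have ab0 : be - al != 0 by rewrite /be /al opprB addrA subrK subr_eq0 eq_sym.
have nc : 0 < normc c2 by rewrite normc_gt0.
pose N y := c0 + c1 * e1 (al * y) + c2 * e1 (be * y).
have NE y : normc (c0 * e1 (l0 * y) + c1 * e1 (l1 * y) + c2 * e1 (l2 * y)) =
   normc (N y).
  rewrite -[RHS]mul1r -(normc_e1 (l0 * y)) -normcM; congr normc.
  rewrite /N !mulrDr !mulrA ![e1 _ * _]mulrC -!mulrA -!e1D.
  by congr (_ + _ * e1 _ + _ * e1 _); rewrite /al /be; ring.
pose P := `|be| * `|al| * `|be - al|.
have P0 : 0 < P by rewrite !mulr_gt0 ?normr_gt0.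
pose r0 := (2 * (1 + `|al| + `|be|))^-1.
have d0 : 0 < 1 + `|al| + `|be| by rewrite -addrA ltr_wpDr ?addr_ge0.
have r00 : 0 < r0 by rewrite invr_gt0 mulr_gt0.
exists (normc c2 * P / 2), r0; split => //.
  by rewrite divr_gt0// mulr_gt0.
move=> si w si0; set ep := _ * si ^+ 3.
pose E y := w <= y <= w + r0 /\ normc (N y) < ep.
have win x y : E x -> E y -> `|x - y| <= r0.
  move=> [/andP[x1 x2] _] [/andP[y1 y2] _].
  by rewrite ler_norml; apply/andP; split; lra.
have scale (k x : R) : `|k| <= `|al| + `|be| -> `|x| <= r0 -> `|k * x| <= 1 / 2.
  move=> hk hx; rewrite normrM.
  apply: (@le_trans _ _ ((1 + `|al| + `|be|) * r0)).
    by apply: ler_pM => //; apply: le_trans hk _; lra.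
  by rewrite /r0 invfM mulrCA divff ?gt_eqF// mulr1 div1r.
have beS : `|be| <= `|al| + `|be| by rewrite lerDr.
have alS : `|al| <= `|al| + `|be| by rewrite lerDl.
have abS : `|be - al| <= `|al| + `|be| by rewrite [leRHS]addrC ler_normB.
have three x y z : E x -> E y -> E z ->
    si < `|y - x| -> si < `|z - x| -> si < `|z - y| -> False.
  move=> Ex Ey Ez yx zx zy.
  have det : c2 * (e1 (al * x) * e1 (be * x)) *
       ((e1 (be * (y - x)) - 1) * (e1 (al * (z - x)) - 1)
       - (e1 (be * (z - x)) - 1) * (e1 (al * (y - x)) - 1)) =
     (N y - N x) * (e1 (al * z) - e1 (al * x))
     - (N z - N x) * (e1 (al * y) - e1 (al * x)).
    have ez (k v : R) : e1 (k * v) = e1 (k * x) * e1 (k * (v - x)).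
      by rewrite -e1D; congr e1; ring.
    by rewrite /N !(ez _ y) !(ez _ z); ring.
  have := det_lower_bound al be (y - x) (z - x).
  have le2 u v : normc (e1 (R:=R) u - e1 v) <= 2.
    by rewrite (le_trans (normcB_le _ _))// !normc_e1.
  have le8 : normc ((N y - N x) * (e1 (al * z) - e1 (al * x))
     - (N z - N x) * (e1 (al * y) - e1 (al * x))) < 8 * ep.
    apply: le_lt_trans (normcB_le _ _) _; rewrite !normcM.
    have hyx : normc (N y - N x) * normc (e1 (al * z) - e1 (al * x)) <=
               normc (N y - N x) * 2 by rewrite ler_wpM2l ?normc_ge0.
    have hzx : normc (N z - N x) * normc (e1 (al * y) - e1 (al * x)) <=
               normc (N z - N x) * 2 by rewrite ler_wpM2l ?normc_ge0.
    have t1 := normcB_le (N y) (N x); have t2 := normcB_le (N z) (N x).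
    have ex := Ex.2; have ey := Ey.2; have ez := Ez.2.
    lra.
  rewrite -det normcM [normc (c2 * _)]normcM normcM !normc_e1 !mulr1 in le8.
  move=> lb; have {lb le8} : normc c2 *
    (chord (be * (y - x)) * chord (al * (z - x)) *
     chord ((be - al) * ((y - x) - (z - x))) / 2) < 8 * ep.
    by apply: le_lt_trans le8; rewrite ler_wpM2l ?normc_ge0.
  apply/negP; rewrite -leNgt.
  have c1' : 2 * (`|be| * si) <= chord (be * (y - x)).
    apply: le_trans (chord_ge (scale _ _ beS (win _ _ Ey Ex))).
    by rewrite normrM ler_wpM2l// ler_wpM2l// ltW.
  have c2' : 2 * (`|al| * si) <= chord (al * (z - x)).
    apply: le_trans (chord_ge (scale _ _ alS (win _ _ Ez Ex))).
    by rewrite normrM ler_wpM2l// ler_wpM2l// ltW.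
  have c3' : 2 * (`|be - al| * si) <= chord ((be - al) * ((y - x) - (z - x))).
    have -> : (y - x) - (z - x) = y - z by ring.
    apply: le_trans (chord_ge (scale _ _ abS (win _ _ Ey Ez))).
    by rewrite normrM ler_wpM2l// ler_wpM2l// ltW// distrC.
  have nn (u : R) : 0 <= 2 * (`|u| * si) by rewrite !mulr_ge0 ?(ltW si0).
  have := ler_pM (mulr_ge0 (nn be) (nn al)) (nn (be - al))
     (ler_pM (nn be) (nn al) c1' c2') c3'.
  set q3 := (X in _ <= X -> _) => hq.
  have : normc c2 * (2 * (`|be| * si) * (2 * (`|al| * si)) * (2 * (`|be - al| * si)) / 2)
     <= normc c2 * (q3 / 2) by rewrite ler_wpM2l ?normc_ge0// ler_wpM2r.
  apply: le_trans; apply: eq_ler.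
  by rewrite /ep /P; field.
have [[a Ea]|nE] := pselect (exists a, E a); last first.
  exists w, w => y wy Ny; exfalso; apply: nE; exists y; split => //.
  by rewrite -NE.
have [[b [Eb ab]]|nE] := pselect (exists b, E b /\ si < `|b - a|); last first.
  exists a, a => y wy Ny; left; rewrite leNgt; apply/negP => ya.
  by apply: nE; exists y; split => //; split => //; rewrite -NE.
exists a, b => y wy Ny.
have Ey : E y by split => //; rewrite -NE.
have [?|ya] := leP `|y - a| si; first by left.
right; rewrite leNgt; apply/negP => yb.
exact: (three a b y).
Qed.

End Sublevel.

(** * Averaging by the mean value theorem *)

Section Selection.
Variable R : realType.

Lemma antiderivative (W : R -> R) (a : R) : continuous W ->
  exists F : R -> R, forall x, a <= x -> is_derive x 1 F (W x).
Proof.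
move=> cW; exists (fun x => \int[@lebesgue_measure R]_(t in [set` `[a - 1, x]]) W t)%R.
move=> x ax.
have xu : x < x + 1 by rewrite ltrDl.
have iW : (@lebesgue_measure R).-integrable `[a - 1, x + 1] (EFin \o W).
  apply: continuous_compact_integrable; first exact: segment_compact.
  exact: continuous_subspaceT.
have ax' : a - 1 < x by rewrite (lt_le_trans _ ax)// gtrBl.
have [d e] := continuous_FTC1_closed xu iW ax' (cW x).
by rewrite derive1E in e; exact: (DeriveDef d e).
Qed.

Lemma is_derive_shift_arg (F : R -> R) (x s d : R) :
  is_derive (x + s) 1 F d -> is_derive x 1 (fun y => F (y + s)) d.
Proof.
move=> h; rewrite -[d]mulr1.
apply: (@is_derive1_comp R F (fun y => y + s)) => //.
by rewrite -[1 in X in is_derive _ _ _ X]addr0; apply: is_deriveD.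
Qed.

Lemma is_derive_bigsum (n : nat) (h dh : nat -> R -> R) (x : R) :
  (forall i, (i < n)%N -> is_derive x 1 (h i) (dh i x)) ->
  is_derive x 1 (fun y => \sum_(i < n) h i y) (\sum_(i < n) dh i x).
Proof.
move=> hd.
have := @is_derive_sum _ _ _ n (fun i : 'I_n => h i) x 1 (fun i : 'I_n => dh i x)
  (fun i => hd i (ltn_ord i)).
congr is_derive; apply/funext => y; by rewrite fct_sumE.
Qed.

Lemma is_derive_bump (c si x : R) : 0 < si ->
  is_derive x 1 (fun y => 2 * si * atan ((y - c) / si)) (2 / (1 + ((x - c) / si) ^+ 2)).
Proof.
move=> si0.
have h : is_derive x 1 (fun y => (y - c) / si) si^-1.
  have h0 : is_derive x 1 (fun y : R => y - c) 1.
    by rewrite -[1 in X in is_derive _ _ _ X]subr0; apply: is_deriveB.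
  have := is_deriveZ (si^-1) h0; rewrite /GRing.scale /= mulr1.
  by congr is_derive; apply/funext => y; rewrite /= mulrC.
have h1 := @is_derive1_comp R (@atan R) (fun y => (y - c) / si) x _ _
  (is_derive1_atan _) h.
have := is_deriveZ (2 * si) h1; rewrite /GRing.scale /=.
have -> : 2 * si * ((1 + ((x - c) / si) ^+ 2)^-1 * si^-1) =
  2 / (1 + ((x - c) / si) ^+ 2).
  have : 1 + ((x - c) / si) ^+ 2 != 0 by rewrite gt_eqF// ltr_pwDl// sqr_ge0.
  by move: (1 + _) => u u0; field; rewrite u0 gt_eqF.
by [].
Qed.

(** Each exceptional interval of half-length [si] is charged to a bump
    [2 / (1 + ((x - c) / si) ^+ 2)], which is at least 1 on it and whose explicit
    antiderivative varies by at most [2 * pi * si]; a point where the derivative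
    of the total is at most its mean then avoids all the intervals. *)
Lemma avoiding_mean_value (n N : nat) (W F : R -> R) (cs : nat -> R) (a r si la : R) :
  0 < r -> 0 < si -> 0 < la -> (forall x, 0 <= W x) ->
  (forall x, a <= x -> is_derive x 1 F (W x)) ->
  \sum_(k < n) (F (a + r + k%:R) - F (a + k%:R)) + la * N%:R * (2 * pi * si) < la * r ->
  exists x, [/\ a <= x <= a + r, \sum_(k < n) W (x + k%:R) <= la
    & forall j, (j < N)%N -> si < `|x - cs j|].
Proof.
move=> r0 si0 la0 W0 dF small.
pose bump c (y : R) := 2 * si * atan ((y - c) / si).
pose dbump c (x : R) := 2 / (1 + ((x - c) / si) ^+ 2).
have dbump0 c x : 0 <= dbump c x by rewrite divr_ge0// addr_ge0// sqr_ge0.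
pose S x := \sum_(k < n) F (x + k%:R) + la * \sum_(j < N) bump (cs j) x.
pose dS x := \sum_(k < n) W (x + k%:R) + la * \sum_(j < N) dbump (cs j) x.
have dSP x : a <= x <= a + r -> is_derive x 1 S (dS x).
  move=> /andP[ax _]; apply: is_deriveD.
    apply: (@is_derive_bigsum n (fun k y => F (y + k%:R)) (fun k y => W (y + k%:R))).
    move=> k _; apply: is_derive_shift_arg; apply: dF.
    by rewrite (le_trans ax)// lerDl.
  apply: (@is_deriveZ _ _ _ (fun y => \sum_(j < N) bump (cs j) y)).
  apply: (@is_derive_bigsum N (fun j => bump (cs j)) (fun j => dbump (cs j))).
  by move=> j _; exact: is_derive_bump.
have ar : a <= a + r by rewrite lerDl ltW.
have [x xI Sx] := mean_value ar dSP.
have atanb (u v : R) : atan u - atan v <= pi.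
  by have := atan_ltpi2 u; have := atan_gtNpi2 v; lra.
have Sle : S (a + r) - S a < la * r.
  apply: le_lt_trans small.
  rewrite /S opprD addrACA -sumrB -mulrBr -sumrB lerD2l -mulrA ler_wpM2l ?(ltW la0)//.
  apply: (@le_trans _ _ (\sum_(j < N) (2 * pi * si))).
    apply: ler_sum => j _; rewrite /bump -mulrBr.
    apply: le_trans (ler_wpM2l _ (atanb _ _)) _; first by rewrite mulr_ge0// ltW.
    by rewrite mulrAC.
  by rewrite sumr_const card_ord [leRHS]mulr_natl.
have dSlt : dS x < la.
  by rewrite -(ltr_pM2r r0); move: Sx; rewrite [a + r - a]addrC addKr => <-.
have sumW0 : 0 <= \sum_(k < n) W (x + k%:R) by exact: sumr_ge0.
have sumb0 : 0 <= \sum_(j < N) dbump (cs j) x by exact: sumr_ge0.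
exists x; split => //.
  by apply: le_trans (ltW dSlt); rewrite lerDl mulr_ge0// ltW.
move=> j jN; rewrite ltNge; apply/negP => xj.
move: dSlt; apply/negP; rewrite -leNgt /dS ler_wpDl//.
rewrite -[leLHS]mulr1 ler_wpM2l ?(ltW la0)//.
rewrite (bigD1 (Ordinal jN)) //= ler_wpDr//; first exact: sumr_ge0.
have y1 : ((x - cs j) / si) ^+ 2 <= 1.
  rewrite -real_normK ?num_real// normrM normfV (gtr0_norm si0) expr_le1//.
    by rewrite ler_pdivrMr// mul1r.
  by rewrite divr_ge0// ltW.
have p0 : 0 < 1 + ((x - cs j) / si) ^+ 2 by rewrite ltr_pwDl// sqr_ge0.
by rewrite /dbump ler_pdivlMr// mul1r; lra.
Qed.

Section Blocks.
Variables (W F : R -> R) (a : R).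
Hypothesis W0 : forall x, 0 <= W x.
Hypothesis dF : forall x, a <= x -> is_derive x 1 F (W x).

Lemma antiderivative_nondecreasing x y : a <= x -> x <= y -> F x <= F y.
Proof.
move=> ax xy.
have [|c _ h] := mean_value xy (df := W) (f := F).
  by move=> z /andP[xz _]; apply: dF; exact: le_trans xz.
by rewrite -subr_ge0 h mulr_ge0// subr_ge0.
Qed.

(** Cut a block of length [q * L] into [q] periods: its variation is that of
    [z |-> \sum_(i < q) F (z + i * L)] over a single period. *)
Lemma antiderivative_block_le (L B : R) (q : nat) : 0 < L ->
  (forall z, \sum_(i < q) W (z + i%:R * L) <= B) ->
  forall p y, a <= y -> F (y + p%:R * (q%:R * L)) - F y <= p%:R * (L * B).
Proof.
move=> L0 hB; have B0 : 0 <= B by apply: le_trans (hB 0); exact: sumr_ge0.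
have one y : a <= y -> F (y + q%:R * L) - F y <= L * B.
  move=> ay.
  have yL : y <= y + L by rewrite lerDl ltW.
  pose Th z := \sum_(i < q) F (z + i%:R * L).
  pose dTh z := \sum_(i < q) W (z + i%:R * L).
  have dThP z : y <= z <= y + L -> is_derive z 1 Th (dTh z).
    move=> /andP[yz _].
    apply: (@is_derive_bigsum q (fun k y => F (y + k%:R * L)) (fun k y => W (y + k%:R * L))).
    move=> k _; apply: is_derive_shift_arg; apply: dF.
    by rewrite (le_trans ay)// (le_trans yz)// lerDl mulr_ge0// ltW.
  have [c _ h] := mean_value yL dThP.
  have -> : F (y + q%:R * L) - F y = Th (y + L) - Th y.
    have := @telescope_sumr R 0 q (fun i => F (y + i%:R * L)) (leq0n q).
    rewrite mul0r addr0 => <-; rewrite big_mkord /Th -sumrB.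
    by apply: eq_bigr => i _; congr (F _ - _); rewrite -natr1; ring.
  by rewrite h addrAC subrr add0r mulrC ler_wpM2l ?(ltW L0)// hB.
move=> p y ay; elim: p => [|p IH]; first by rewrite !mul0r addr0 subrr.
have := one (y + p%:R * (q%:R * L)) _.
have -> : y + p%:R * (q%:R * L) + q%:R * L = y + p.+1%:R * (q%:R * L).
  by rewrite -natr1; ring.
move=> h; have {}h : F (y + p.+1%:R * (q%:R * L)) - F (y + p%:R * (q%:R * L)) <= L * B.
  by apply: h; rewrite (le_trans ay)// lerDl !mulr_ge0// ltW.
rewrite -[p.+1%:R in leRHS]natr1 mulrDl mul1r; lra.
Qed.

Lemma unit_translates_le (r : R) (n : nat) : 0 <= r -> r <= 1 ->
  \sum_(k < n) (F (a + r + k%:R) - F (a + k%:R)) <= F (a + n%:R) - F a.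
Proof.
move=> r0 r1.
have := @telescope_sumr R 0 n (fun i => F (a + i%:R)) (leq0n n).
rewrite addr0 => <-; rewrite big_mkord; apply: ler_sum => k _.
rewrite lerD2r; apply: antiderivative_nondecreasing.
  by rewrite -addrA lerDl addr_ge0.
by rewrite -addrA lerD2l -natr1; lra.
Qed.

End Blocks.

Lemma functional_equation_iterate (g D N : R -> R) :
  (forall x, g (x + 1) * D x = g x * N x) ->
  forall (n : nat) x, g (x + n%:R) * \prod_(k < n) D (x + k%:R) =
            g x * \prod_(k < n) N (x + k%:R).
Proof.
move=> e n x; elim: n => [|n IH]; first by rewrite !big_ord0 addr0.
rewrite !big_ord_recr /= -natr1 addrA.
have -> : g (x + n%:R + 1) * (\prod_(i < n) D (x + i%:R) * D (x + n%:R)) =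
  (g (x + n%:R + 1) * D (x + n%:R)) * \prod_(i < n) D (x + i%:R) by ring.
by rewrite e mulrAC IH mulrA.
Qed.

End Selection.

(** * Rapidly decaying solutions of the recurrence *)

Section Core.
Variable R : realType.

Lemma periodic_subn (T : Type) (f : R -> T) (L : R) :
  (forall x, f (x + L) = f x) -> forall (n : nat) x, f (x - n%:R * L) = f x.
Proof.
move=> per n; elim: n => [|n IH] x; first by rewrite mul0r subr0.
rewrite -[RHS]IH -[LHS]per; congr f; rewrite -natr1; ring.
Qed.

Lemma periodic_addn (T : Type) (f : R -> T) (L : R) :
  (forall x, f (x + L) = f x) -> forall (n : nat) x, f (x + n%:R * L) = f x.
Proof. by move=> per n x; rewrite -(periodic_subn per n) addrK. Qed.

Lemma expR_sum (n : nat) (w : nat -> R) :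
  expR (\sum_(k < n) w k) = \prod_(k < n) expR (w k).
Proof.
elim: n => [|n IH]; first by rewrite !big_ord0 expR0.
by rewrite !big_ord_recr /= expRD IH.
Qed.

(** Iterate the recurrence from [x] and from [x - T]: the factors [D] agree since
    [T] is a period, and each factor [N] changes at most by [expR (W _)]. *)
Lemma return_inequality (g D N W : R -> R) (n : nat) (x T : R) :
  (forall x, 0 <= g x) ->
  (forall x, g (x + 1) * D x = g x * N x) ->
  (forall y, D (y - T) = D y) ->
  (forall k, (k < n)%N -> 0 < D (x + k%:R)) ->
  (forall k, (k < n)%N -> 0 < N (x + k%:R)) ->
  (forall y, 0 <= N y) ->
  (forall k, (k < n)%N -> N (x + k%:R - T) <= N (x + k%:R) * expR (W (x + k%:R))) ->
  g x * g (x + n%:R - T) <=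
    g (x + n%:R) * g (x - T) * expR (\sum_(k < n) W (x + k%:R)).
Proof.
move=> g0 eqn Dper D0 N0 Nnn NT.
have e1' := functional_equation_iterate eqn n x.
have e2 := functional_equation_iterate eqn n (x - T).
set PD := \prod_(k < n) D (x + k%:R) in e1'.
set PN := \prod_(k < n) N (x + k%:R) in e1'.
have shift_sub (k : nat) : x - T + k%:R = x + k%:R - T by ring.
have PDE : \prod_(k < n) D (x - T + k%:R) = PD.
  by apply: eq_bigr => k _; rewrite shift_sub Dper.
rewrite PDE shift_sub in e2.
have PD0 : 0 < PD by apply: prodr_gt0 => k _; exact: D0.
have PN0 : 0 < PN by apply: prodr_gt0 => k _; exact: N0.
have PNT : \prod_(k < n) N (x - T + k%:R) <= PN * expR (\sum_(k < n) W (x + k%:R)).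
  rewrite (expR_sum n (fun k => W (x + k%:R))) -big_split /=.
  by apply: ler_prod => k _; rewrite shift_sub Nnn NT.
rewrite -(ler_pM2r (mulr_gt0 PN0 PD0)).
have -> : g x * g (x + n%:R - T) * (PN * PD) =
  (g x * PN) * (g (x + n%:R - T) * PD) by ring.
rewrite -e1' e2.
have -> : g (x + n%:R) * g (x - T) * expR (\sum_(k < n) W (x + k%:R)) * (PN * PD) =
  (g (x + n%:R) * PD) * (g (x - T) * (PN * expR (\sum_(k < n) W (x + k%:R)))) by ring.
by rewrite ler_wpM2l ?mulr_ge0 ?(ltW PD0)// ler_wpM2l.
Qed.

(** The cut-off [ka * (s1 / q) ^+ 3] is a negative power of [q] up to a
    constant, so the bound of
    [sum_log_near_circle_le] is logarithmic. *)
Lemma block_constant_log (c : R[i]) (Kp ka s1 : R) : c != 0 -> 0 <= Kp -> 0 < ka -> 0 < s1 ->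
  exists E0 E1 : R, [/\ 0 <= E0, 0 <= E1 & forall q : nat, (0 < q)%N ->
    ln (1 + 2 * Kp / (ka * (s1 / q%:R) ^+ 3)) +
    12 * Kp / normc c * (2 * harmonic_sum R q + 1) <= E0 + E1 * ln q%:R].
Proof.
move=> c0 K0 ka0 s10.
have nc : 0 < normc c by rewrite normc_gt0.
pose P := 2 * Kp / (ka * s1 ^+ 3); pose C := 12 * Kp / normc c.
have P0 : 0 <= P by rewrite divr_ge0 ?mulr_ge0 ?exprn_ge0// ltW.
have C0 : 0 <= C by rewrite divr_ge0 ?mulr_ge0// ltW.
exists (ln (1 + P) + 3 * C), (3 + 2 * C); split.
- by rewrite addr_ge0//; [rewrite ln_ge0// lerDl|rewrite mulr_ge0].
- by rewrite addr_ge0// mulr_ge0.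
move=> q q0; have q1 : 1 <= q%:R :> R by rewrite ler1n.
have q0R : 0 < q%:R :> R by rewrite ltr0n.
have lq0 : 0 <= ln q%:R :> R by rewrite ln_ge0.
have q3 : 1 <= q%:R ^+ 3 :> R by rewrite exprn_ege1.
have e : 2 * Kp / (ka * (s1 / q%:R) ^+ 3) = P * q%:R ^+ 3.
  by rewrite /P; field; rewrite ?gt_eqF.
have h1 : ln (1 + 2 * Kp / (ka * (s1 / q%:R) ^+ 3)) <= ln (1 + P) + 3 * ln q%:R.
  have -> : 3 * ln q%:R = ln (q%:R ^+ 3) :> R by rewrite lnXn// mulr_natl.
  rewrite -lnM ?posrE ?ltr_pwDl ?exprn_gt0// e.
  rewrite ler_ln ?posrE; last 2 first.
  - by rewrite ltr_pwDl// mulr_ge0// exprn_ge0// ltW.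
  - by rewrite mulr_gt0 ?exprn_gt0// ltr_pwDl.
  by rewrite mulrDl mul1r lerD2r.
have h2 : C * (2 * harmonic_sum R q + 1) <= C * (2 * (1 + ln q%:R) + 1).
  by rewrite ler_wpM2l// lerD2r ler_wpM2l// harmonic_sum_le.
rewrite -/C; lra.
Qed.

(** Two thin functions [D] and [N] contribute at most four exceptional
    intervals to each of the [n] translates of the window [[a, a + r]]. *)
Lemma small_distortion_point (n : nat) (W F D N : R -> R)
    (a r si la kaD rD kaN rN : R) :
  0 < r -> 0 < si -> 0 < la -> (forall x, 0 <= W x) ->
  (forall x, a <= x -> is_derive x 1 F (W x)) ->
  r <= rD -> r <= rN ->
  (forall si w, 0 < si -> exists u v, forall y, w <= y <= w + rD ->
     D y < kaD * si ^+ 3 -> `|y - u| <= si \/ `|y - v| <= si) ->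
  (forall si w, 0 < si -> exists u v, forall y, w <= y <= w + rN ->
     N y < kaN * si ^+ 3 -> `|y - u| <= si \/ `|y - v| <= si) ->
  \sum_(k < n) (F (a + r + k%:R) - F (a + k%:R)) +
    la * (4 * n)%:R * (2 * pi * si) < la * r ->
  exists x, [/\ a <= x <= a + r, \sum_(k < n) W (x + k%:R) <= la,
    forall k, (k < n)%N -> kaD * si ^+ 3 <= D (x + k%:R)
    & forall k, (k < n)%N -> kaN * si ^+ 3 <= N (x + k%:R)].
Proof.
move=> r0 si0 la0 W0 dF rrD rrN thinD thinN small.
have /choice[uD /choice[vD wD]] := fun k : nat => thinD si (a + k%:R) si0.
have /choice[uN /choice[vN wN]] := fun k : nat => thinN si (a + k%:R) si0.
pose cs (j : nat) := let k := (j %/ 4)%N in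
  (if (j %% 4 == 0)%N then uD k else if (j %% 4 == 1)%N then vD k
   else if (j %% 4 == 2)%N then uN k else vN k) - k%:R.
have [x [xI sumW avoid]] := @avoiding_mean_value _ n (4 * n) W F cs a r si la
  r0 si0 la0 W0 dF small.
have win k (ra : R) : r <= ra -> a + k%:R <= x + k%:R <= a + k%:R + ra.
  by move: xI => /andP[xI1 xI2] rra; apply/andP; split; lra.
have far k (i : nat) (z : R) : (k < n)%N -> (i < 4)%N -> cs (4 * k + i)%N = z - k%:R ->
    si < `|x + k%:R - z|.
  move=> kn i4 e; have j0 : (4 * k + i < 4 * n)%N by clear -kn i4; lia.
  by have := avoid _ j0; rewrite e opprB addrA.
have div4 k i : (i < 4)%N -> ((4 * k + i) %/ 4 = k)%N.
  by move=> i4; rewrite mulnC divnMDl// divn_small// addn0.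
have mod4 k i : (i < 4)%N -> ((4 * k + i) %% 4 = i)%N.
  by move=> i4; rewrite mulnC modnMDl modn_small.
exists x; split => // k kn; rewrite leNgt; apply/negP => lt.
- have f0 : si < `|x + k%:R - uD k|.
    by apply: (far k 0%N) => //; rewrite /cs div4 ?mod4.
  have f1 : si < `|x + k%:R - vD k|.
    by apply: (far k 1%N) => //; rewrite /cs div4 ?mod4.
  by have [] := wD k _ (win k rD rrD) lt; rewrite leNgt ?f0 ?f1.
- have f0 : si < `|x + k%:R - uN k|.
    by apply: (far k 2%N) => //; rewrite /cs div4 ?mod4.
  have f1 : si < `|x + k%:R - vN k|.
    by apply: (far k 3%N) => //; rewrite /cs div4 ?mod4.
  by have [] := wN k _ (win k rN rrN) lt; rewrite leNgt ?f0 ?f1.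
Qed.

(** Suppose [g x1 > 0].  Take [T = m * (q * L)] with [q] a best denominator of
    [be * L] and [m <= M] such that [T] is within [M^-1] of an integer [n].  By
    [return_inequality], [g x * g (x + n - T)], which is bounded below near
    [x1], is at most [g (x + n) * g (x - T)] times the exponential of the
    distortion.  For a suitable [x] the distortion is [O(log q)] and its
    exponential a power [q ^+ K], whereas [g (x + n)] decays like [q ^- K.+1]. *)
Lemma rapidly_decaying_solution_eq0 (g D : R -> R) (A : R -> R[i]) (c : R[i]) (be L : R) :
  let N y := normc (A y + c * e1 (be * y)) in
  (forall x, 0 <= g x) -> continuous g ->
  (forall K : nat, exists M : R, forall x, `|x| ^+ K * g x <= M) ->
  0 < L -> (forall x, D (x + L) = D x) -> (forall x, 0 <= D x) ->
  (forall x, A (x + L) = A x) -> continuous N -> c != 0 ->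
  thin_sublevels D -> thin_sublevels N ->
  (forall x, g (x + 1) * D x = g x * N x) ->
  forall x, g x = 0.
Proof.
move=> N g0 cg decay L0 Dper D0 Aper cN c0.
move=> [kaD [rD [kaD0 rD0 thinD]]] [kaN [rN [kaN0 rN0 thinN]]] eqn x1.
have [//|gx1] := eqVneq (g x1) 0.
have {gx1} gx1 : 0 < g x1 by rewrite lt_def gx1 g0.
exfalso.
have nc : 0 < normc c by rewrite normc_gt0.
have p0 : 0 < pi :> R := pi_gt0 R.
have N0 y : 0 <= N y by exact: normc_ge0.
pose c1 := g x1 / 2; have c10 : 0 < c1 by rewrite divr_gt0.
have [h h0 gh] : exists2 h : R, 0 < h & forall y, `|y - x1| <= h -> c1 <= g y.
  have /cvgrPdist_lt /(_ c1 c10) /nbhs_ballP [e /= e0 he] := cg x1.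
  exists (e / 2); first by rewrite divr_gt0.
  move=> y hy; have : `|g x1 - g y| < c1.
    by apply: he; rewrite /ball /= distrC (le_lt_trans hy)// gtr_pMr// invf_lt1// ltr1n.
  by have := ler_norm (g x1 - g y); rewrite /c1; lra.
pose M := (Num.trunc (2 / h)).+1.
have M0 : 0 < M%:R :> R by rewrite ltr0n.
have Mh : M%:R^-1 <= h / 2.
  have h2 : 0 <= 2 / h by rewrite divr_ge0// ltW.
  have /andP[_ h3] := truncn_itv h2.
  rewrite -[leRHS]invrK lef_pV2 ?posrE ?invr_gt0 ?divr_gt0// invf_div.
  exact: ltW.
(* half of the room [h] is left for [x - x1], the other half for [T - n] *)
pose r := Num.min (Num.min 1 (h / 2)) (Num.min rD rN).
have r0 : 0 < r by rewrite !lt_min ltr01 divr_gt0// rD0 rN0.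
have [r1 rh rrD rrN] : [/\ r <= 1, r <= h / 2, r <= rD & r <= rN].
  by split; rewrite /r !ge_min lexx ?orbT.
pose Kp := 2 * M%:R * normc c.
have Kp0 : 0 <= Kp by rewrite !mulr_ge0// ltW.
(* small enough for the [4 * n] exceptional intervals, of half-length [s1 / q],
   to be charged at most [r / 2] *)
pose s1 := r / (16 * pi * (M.+1)%:R * L).
have M10 : 0 < M.+1%:R :> R by rewrite ltr0n.
have den0 : 0 < 16 * pi * M.+1%:R * L by rewrite !mulr_gt0.
have s10 : 0 < s1 by rewrite divr_gt0.
have [E0 [E1 [E00 E10 BE]]] := block_constant_log c0 Kp0 kaN0 s10.
pose ga := be * L.
(* [lam q] exceeds four times the mean distortion over the window, so that the
   distortion and the exceptional intervals use at most 3/4 of [lam q * r] *)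
pose lam (q : nat) : R := 4 * M.+1%:R * L * (E0 + E1 * ln q%:R) / r + 1.
pose F0 := 4 * M.+1%:R * L * E0 / r + 1.
pose F1 := 4 * M.+1%:R * L * E1 / r.
have F10 : 0 <= F1 by rewrite divr_ge0 ?mulr_ge0// ?ltW.
have lamE q : lam q = F0 + F1 * ln q%:R by rewrite /lam /F0 /F1; field; rewrite gt_eqF.
pose K := (Num.trunc F1).+1.
have F1K : F1 <= K%:R by have /andP[_ /ltW] := truncn_itv F10.
have [m0 gm0] := decay 0%N.
have [mK gmK] := decay K.+1.
have m00 : 0 <= m0 by apply: le_trans (gm0 0); rewrite mulr_ge0.
have mK0 : 0 <= mK by apply: le_trans (gmK 0); rewrite mulr_ge0// exprn_ge0.
pose cc := c1 ^+ 2 * (L / 2) ^+ K.+1.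
have cc0 : 0 < cc by rewrite mulr_gt0// exprn_gt0// divr_gt0.
pose CC := mK * m0 * expR F0.
pose X := 2 * (1 + `|x1|) / L + CC / cc.
have [q [qX q0 rec]] := best_denominators ga (Num.trunc X).+1.
have CC0 : 0 <= CC by rewrite !mulr_ge0 ?expR_ge0.
have a1 : 0 <= 2 * (1 + `|x1|) / L by rewrite divr_ge0 ?mulr_ge0 ?addr_ge0// ltW.
have a2 : 0 <= CC / cc by rewrite divr_ge0// ltW.
have X0 : 0 <= X by rewrite addr_ge0.
have q0R : 0 < q%:R :> R by rewrite ltr0n.
have qX' : X < q%:R.
  have /andP[_ hX] := truncn_itv X0; apply: lt_le_trans hX _.
  by rewrite ler_nat.
have qL : 2 * (1 + `|x1|) < q%:R * L.
  by rewrite -ltr_pdivrMr//; apply: le_lt_trans qX'; rewrite /X lerDl.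
have qC : CC < q%:R * cc.
  by rewrite -ltr_pdivrMr//; apply: le_lt_trans qX'; rewrite /X lerDr.
have [m [m0' mM [nz hn]]] := dirichlet (q%:R * L) (isT : (0 < M)%N).
have m1 : 1 <= m%:R :> R by rewrite ler1n.
pose T := m%:R * (q%:R * L).
have TqL : q%:R * L <= T by rewrite /T ler_peMl// mulr_ge0// ltW.
have TM : T <= M%:R * (q%:R * L) by rewrite ler_wpM2r ?mulr_ge0 ?ler_nat ?(ltW L0).
have nx1 := normr_ge0 x1.
have M1 : M%:R^-1 <= 1 :> R by rewrite invf_le1// ler1n.
have [n nE] : exists n : nat, nz = n.
  case: nz hn => [n|n] hn; first by exists n.
  move: hn; rewrite NegzE mulrNz ler_norml => /andP[_]; rewrite -/T opprK => hn.
  have : 0 <= n.+1%:~R :> R by exact: ler0n.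
  by move=> h1; exfalso; clear -h1 hn qL nx1 TqL M1; lra.
move: hn; rewrite nE -/T -[_%:~R]/(n%:R) => hn {nz nE}.
have /andP[hn1 hn2] : - M%:R^-1 <= T - n%:R <= M%:R^-1 by rewrite -ler_norml.
have nT : n%:R <= M.+1%:R * (q%:R * L).
  rewrite -[M.+1%:R]natr1 mulrDl mul1r; clear -hn1 TM qL nx1 M1; lra.
have nlow : q%:R * L - 1 <= n%:R by clear -hn2 TqL M1; lra.
(* the cut-off [ep] makes [W] continuous; it costs the factor 2 in [Kp], as
   [N y + ep <= 2 * N y] where [ep <= N y] *)
pose de := chord (q%:R * ga).
pose si := s1 / q%:R.
have si0 : 0 < si by rewrite divr_gt0.
pose ep := kaN * si ^+ 3.
have ep0 : 0 < ep by rewrite mulr_gt0// exprn_gt0.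
have Ne y : 0 < N y + ep by rewrite ltr_wpDl.
have de0 : 0 <= de by exact: chord_ge0.
pose W y := ln (1 + Kp * de / (N y + ep)).
have arg1 y : 1 <= 1 + Kp * de / (N y + ep).
  by rewrite lerDl divr_ge0 ?mulr_ge0// ltW.
have W0 y : 0 <= W y by rewrite ln_ge0.
have cW : continuous W.
  move=> y; apply: (@continuous_comp _ _ _ (fun y => 1 + Kp * de / (N y + ep)) (@ln R)).
    apply: cvgD; first exact: cvg_cst.
    apply: cvgM; first exact: cvg_cst.
    apply: cvgV; first by rewrite gt_eqF.
    by apply: cvgD; [exact: cN|exact: cvg_cst].
  by apply: continuous_ln; rewrite (lt_le_trans ltr01).
have [F dF] := antiderivative x1 cW.
pose B := E0 + E1 * ln q%:R.
have lq0 : 0 <= ln q%:R :> R by rewrite ln_ge0// ler1n.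
have B0 : 0 <= B by rewrite addr_ge0// mulr_ge0.
have blk z : \sum_(i < q) W (z + i%:R * L) <= B.
  apply: le_trans (BE q q0).
  apply: le_trans (sum_log_near_circle_le (A z) (be * z) c0 Kp0 ep0 q0 rec).
  apply: ler_sum => i _; rewrite /W /N (periodic_addn Aper).
  have -> : be * (z + i%:R * L) = be * z + i%:R * ga by rewrite /ga; ring.
  exact: lexx.
have la0 : 0 < lam q.
  by rewrite ltr_wpDl// divr_ge0 ?mulr_ge0// ltW.
have small : \sum_(k < n) (F (x1 + r + k%:R) - F (x1 + k%:R)) +
    lam q * (4 * n)%:R * (2 * pi * si) < lam q * r.
  have s1' := unit_translates_le W0 dF n (ltW r0) r1.
  have s2 : F (x1 + n%:R) - F x1 <= M.+1%:R * (L * B).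
    apply: le_trans (antiderivative_block_le W0 dF L0 blk M.+1 (lexx x1)).
    rewrite lerD2r (antiderivative_nondecreasing W0 dF)//.
      by rewrite lerDl.
    by rewrite lerD2l.
  have s3 : (4 * n)%:R * (2 * pi * si) <= r / 2.
    rewrite natrM.
    have : n%:R * si <= M.+1%:R * L * s1.
      apply: (@le_trans _ _ (M.+1%:R * (q%:R * L) * si)).
        by rewrite ler_wpM2r// ltW.
      by apply: eq_ler; rewrite /si; field; rewrite gt_eqF.
    move=> hh; have {}hh : 8 * pi * (n%:R * si) <= 8 * pi * (M.+1%:R * L * s1).
      by rewrite ler_wpM2l// mulr_ge0// ltW.
    have e : 8 * pi * (M.+1%:R * L * s1) = r / 2.
      have := divfK (lt0r_neq0 den0) r; rewrite -/s1 => er.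
      by rewrite -er; field.
    by rewrite -e; apply: le_trans hh; apply: eq_ler; ring.
  have s4 : lam q * ((4 * n)%:R * (2 * pi * si)) <= lam q * (r / 2).
    by rewrite ler_wpM2l// ltW.
  have s5 : lam q * r = 4 * (M.+1%:R * (L * B)) + r.
    by rewrite /lam -/B; field; rewrite gt_eqF.
  have s6 : 0 <= M.+1%:R * (L * B) by rewrite !mulr_ge0// ltW.
  rewrite -mulrA; clear -s1' s2 s4 s5 s6 r0; lra.
have [x [/andP[xI1 xI2] sumW Dlow Nlow]] :=
  small_distortion_point r0 si0 la0 W0 dF rrD rrN thinD thinN small.
have TE : T = (m * q)%:R * L by rewrite /T natrM mulrA.
have NT k : (k < n)%N -> N (x + k%:R - T) <= N (x + k%:R) * expR (W (x + k%:R)).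
  move=> kn; set y := x + k%:R.
  have Ny := Nlow k kn; rewrite -/y in Ny.
  rewrite /W lnK ?posrE; last by rewrite (lt_le_trans ltr01).
  have s1' : N (y - T) <= N y + M%:R * normc c * de.
    rewrite /N TE (periodic_subn Aper) -TE.
    have -> : A y + c * e1 (be * (y - T)) = (A y + c * e1 (be * y)) +
       c * (e1 (be * (y - T)) - e1 (be * y)) by ring.
    apply: le_trans (normcD_le _ _) _; rewrite lerD2l normcM chord_e1B.
    have -> : be * (y - T) - be * y = - (m%:R * (q%:R * ga)) by rewrite /T /ga; ring.
    rewrite chordN mulrAC [leRHS]mulrC ler_wpM2l ?normc_ge0//.
    apply: le_trans (chordMn _ _) _.
    by rewrite ler_wpM2r// ler_nat.
  apply: le_trans s1' _; rewrite mulrDr mulr1 lerD2l.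
  have -> : N y * (Kp * de / (N y + ep)) = M%:R * normc c * de * (2 * N y / (N y + ep)).
    by rewrite /Kp; field; rewrite gt_eqF.
  have Mc0 : 0 <= M%:R * normc c * de by rewrite !mulr_ge0// ltW.
  rewrite ler_peMr// ler_pdivlMr// mul1r mulr_natl mulr2n lerD2l.
  exact: Ny.
have DperT y : D (y - T) = D y by rewrite TE (periodic_subn Dper).
have epD0 : 0 < kaD * si ^+ 3 by rewrite mulr_gt0// exprn_gt0.
have key := return_inequality g0 eqn DperT
  (fun k kn => lt_le_trans epD0 (Dlow k kn))
  (fun k kn => lt_le_trans ep0 (Nlow k kn)) N0 NT.
have gx : c1 <= g x by apply: gh; rewrite ler_norml; apply/andP; clear -xI1 xI2 rh h0; split; lra.
have gxT : c1 <= g (x + n%:R - T).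
  apply: gh; rewrite ler_norml; apply/andP.
  by clear -xI1 xI2 rh Mh hn1 hn2 h0; split; lra.
have gT : g (x - T) <= m0 by have := gm0 (x - T); rewrite expr0 mul1r.
have xn : q%:R * L / 2 <= `|x + n%:R|.
  apply: le_trans (ler_norm _); have := ler_norm (- x1); rewrite normrN => hx.
  clear -hx xI1 nlow qL nx1; lra.
have gn : (q%:R * L / 2) ^+ K.+1 * g (x + n%:R) <= mK.
  apply: le_trans (gmK (x + n%:R)); rewrite ler_wpM2r//.
  by rewrite lerXn2r ?nnegrE// divr_ge0// mulr_ge0// ltW.
have eW : expR (\sum_(k < n) W (x + k%:R)) <= expR F0 * q%:R ^+ K.
  apply: (@le_trans _ _ (expR (F0 + F1 * ln q%:R))).
    by rewrite ler_expR -lamE.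
  rewrite expRD ler_wpM2l ?expR_ge0//.
  apply: (@le_trans _ _ (expR (K%:R * ln q%:R))).
    by rewrite ler_expR ler_wpM2r.
  by rewrite expRM_natl lnK ?posrE.
have c1c : c1 ^+ 2 <= g x * g (x + n%:R - T).
  by rewrite expr2 ler_pM// ltW.
have f1 : c1 ^+ 2 * (q%:R * L / 2) ^+ K.+1 <= CC * q%:R ^+ K.
  have qp : 0 <= (q%:R * L / 2) ^+ K.+1 by rewrite exprn_ge0// divr_ge0// mulr_ge0// ltW.
  apply: (@le_trans _ _ (g (x + n%:R) * g (x - T) * expR (\sum_(k < n) W (x + k%:R))
     * (q%:R * L / 2) ^+ K.+1)).
    by rewrite ler_wpM2r// (le_trans c1c).
  have -> : CC * q%:R ^+ K = mK * m0 * (expR F0 * q%:R ^+ K) by rewrite /CC; ring.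
  have -> : g (x + n%:R) * g (x - T) * expR (\sum_(k < n) W (x + k%:R))
     * (q%:R * L / 2) ^+ K.+1 = ((q%:R * L / 2) ^+ K.+1 * g (x + n%:R)) * g (x - T) *
     expR (\sum_(k < n) W (x + k%:R)) by ring.
  apply: ler_pM eW; [|exact: expR_ge0|].
    by rewrite mulr_ge0// mulr_ge0.
  by apply: ler_pM => //; rewrite mulr_ge0.
have f2 : c1 ^+ 2 * (q%:R * L / 2) ^+ K.+1 = q%:R * cc * q%:R ^+ K.
  have -> : q%:R * L / 2 = q%:R * (L / 2) by rewrite mulrA.
  rewrite /cc (exprMn K.+1 q%:R) (exprS q%:R).
  by move: (c1 ^+ 2) ((L / 2) ^+ K.+1) (q%:R ^+ K) => u v w; ring.
rewrite f2 ler_pM2r ?exprn_gt0// in f1.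
by move: qC; rewrite ltNge f1.
Qed.

End Core.

(** * Four points on two vertical lines *)

Section Vertical.
Variable R : realType.
Implicit Types (F : R -> R[i]) (g : R -> R).

Definition rapidly_decaying (g : R -> R) : Prop :=
  forall K : nat, exists M : R, forall x, `|x| ^+ K * g x <= M.

Lemma continuous_normc F :
  continuous (fun x => complex.Re (F x)) -> continuous (fun x => complex.Im (F x)) ->
  continuous (fun x => normc (F x)).
Proof.
move=> cR cI.
have -> : (fun x => normc (F x)) =
    (fun x => Num.sqrt (complex.Re (F x) ^+ 2 + complex.Im (F x) ^+ 2)).
  by apply/funext => x; case: (F x).
move=> x; apply: (@continuous_comp _ _ _
  (fun x => complex.Re (F x) ^+ 2 + complex.Im (F x) ^+ 2) (@Num.sqrt R)); last first.
  exact: sqrt_continuous.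
apply: cvgD; rewrite /=.
  by apply: (@continuous_comp _ _ _ (fun x => complex.Re (F x)) (fun u => u ^+ 2));
    [exact: cR|exact: exprn_continuous].
by apply: (@continuous_comp _ _ _ (fun x => complex.Im (F x)) (fun u => u ^+ 2));
    [exact: cI|exact: exprn_continuous].
Qed.

Lemma continuous_cos_lin (l : R) : continuous (fun x : R => cos (2 * pi * (l * x))).
Proof.
move=> x; apply: (@continuous_comp _ _ _ (fun x : R => 2 * pi * (l * x)) (@cos R)).
  by apply: cvgM; [exact: cvg_cst|apply: cvgM; [exact: cvg_cst|exact: cvg_id]].
exact: continuous_cos.
Qed.

Lemma continuous_sin_lin (l : R) : continuous (fun x : R => sin (2 * pi * (l * x))).
Proof.
move=> x; apply: (@continuous_comp _ _ _ (fun x : R => 2 * pi * (l * x)) (@sin R)).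
  by apply: cvgM; [exact: cvg_cst|apply: cvgM; [exact: cvg_cst|exact: cvg_id]].
exact: continuous_sin.
Qed.

Lemma continuous_trig3 (c0 c1 c2 : R[i]) (l1 l2 : R) :
  continuous (fun y => normc (c0 + c1 * e1 (l1 * y) + c2 * e1 (l2 * y))).
Proof.
apply: continuous_normc => x.
  have -> : (fun x : R => complex.Re (c0 + c1 * e1 (l1 * x) + c2 * e1 (l2 * x))) =
   (fun x : R => complex.Re c0
     + (complex.Re c1 * cos (2 * pi * (l1 * x)) - complex.Im c1 * sin (2 * pi * (l1 * x)))
     + (complex.Re c2 * cos (2 * pi * (l2 * x)) - complex.Im c2 * sin (2 * pi * (l2 * x)))).
    by apply/funext => y; case: c0 c1 c2 => [a b] [u v] [s t].
  apply: cvgD; [apply: cvgD; first exact: cvg_cst|]; (apply: cvgB; apply: cvgM;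
    [exact: cvg_cst|exact: continuous_cos_lin|exact: cvg_cst|exact: continuous_sin_lin]).
have -> : (fun x : R => complex.Im (c0 + c1 * e1 (l1 * x) + c2 * e1 (l2 * x))) =
 (fun x : R => complex.Im c0
   + (complex.Re c1 * sin (2 * pi * (l1 * x)) + complex.Im c1 * cos (2 * pi * (l1 * x)))
   + (complex.Re c2 * sin (2 * pi * (l2 * x)) + complex.Im c2 * cos (2 * pi * (l2 * x)))).
  by apply/funext => y; case: c0 c1 c2 => [a b] [u v] [s t].
apply: cvgD; [apply: cvgD; first exact: cvg_cst|]; (apply: cvgD; apply: cvgM;
  [exact: cvg_cst|exact: continuous_sin_lin|exact: cvg_cst|exact: continuous_cos_lin]).
Qed.

(** A window on which [g] does not vanish would lie near two points. *)
Lemma vanish_off_thin g (G : R -> R) :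
  continuous g -> thin_sublevels G -> (forall x, g x * G x = 0) -> forall x, g x = 0.
Proof.
move=> cg [ka [r0 [ka0 r00 thin]]] gG x.
have [//|gx] := eqVneq (g x) 0; exfalso.
have ax : 0 < `|g x| by rewrite normr_gt0.
have /cvgrPdist_lt /(_ _ ax) /nbhs_ballP [e /= e0 he] := cg x.
pose r := Num.min r0 (e / 2); have rp : 0 < r by rewrite lt_min r00 divr_gt0.
have [rr0 re] : r <= r0 /\ r <= e / 2 by rewrite /r !ge_min !lexx orbT.
have si0 : 0 < r / 12 by rewrite divr_gt0.
have [a [b hab]] := thin (r / 12) x si0.
have zero y : x <= y <= x + r -> `|y - a| <= r / 12 \/ `|y - b| <= r / 12.
  move=> /andP[xy yx]; apply: hab; first by apply/andP; split; lra.
  have gy : g y != 0.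
    have : `|g x - g y| < `|g x|.
      by apply: he; rewrite /ball /= distrC ger0_norm ?subr_ge0//; lra.
    by apply: contraTneq => ->; rewrite subr0 ltxx.
  have /eqP := gG y; rewrite mulf_eq0 (negbTE gy) /= => /eqP ->.
  by rewrite mulr_gt0// exprn_gt0.
(* three points of the window cannot lie near two centres *)
have h0 := zero x; have h1 := zero (x + r / 2); have h2 := zero (x + r).
have {}h0 := h0 ltac:(apply/andP; split; clear -rp; lra).
have {}h1 := h1 ltac:(apply/andP; split; clear -rp; lra).
have {}h2 := h2 ltac:(apply/andP; split; clear -rp; lra).
have near (c u v : R) : `|u - c| <= r / 12 -> `|v - c| <= r / 12 -> `|u - v| <= r / 6.
  rewrite !ler_norml => /andP[u1 u2] /andP[v1 v2].
  by apply/andP; split; clear -u1 u2 v1 v2; lra.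
have far (u v : R) : `|u - v| <= r / 6 -> r / 2 <= v - u -> False.
  by rewrite ler_norml => /andP[u1 u2] uv; clear -u1 u2 uv rp; lra.
have d01 : r / 2 <= (x + r / 2) - x by clear; lra.
have d12 : r / 2 <= (x + r) - (x + r / 2) by clear; lra.
have d02 : r / 2 <= (x + r) - x by clear -rp; lra.
case: h0 h1 h2 => k0 [k1|k1] [k2|k2].
- exact: far (near _ _ _ k0 k1) d01.
- exact: far (near _ _ _ k0 k1) d01.
- exact: far (near _ _ _ k0 k2) d02.
- exact: far (near _ _ _ k1 k2) d12.
- exact: far (near _ _ _ k1 k2) d12.
- exact: far (near _ _ _ k0 k2) d02.
- exact: far (near _ _ _ k0 k1) d01.
- exact: far (near _ _ _ k0 k1) d01.
Qed.

Lemma one_period_core g (p0 p1 c0 c1 c2 : R[i]) (al be : R) :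
  let D y := normc (p0 + p1 * e1 (al * y)) in
  let N y := normc (c0 + c1 * e1 (al * y) + c2 * e1 (be * y)) in
  (forall x, 0 <= g x) -> continuous g -> rapidly_decaying g ->
  al != 0 -> c2 != 0 -> thin_sublevels D -> thin_sublevels N ->
  (forall x, g (x + 1) * D x = g x * N x) -> forall x, g x = 0.
Proof.
move=> D N g0 cg dg al0 c20 tD tN eqn.
have per x : e1 (al * (x + `|al|^-1)) = e1 (al * x).
  rewrite mulrDr e1D.
  have [ap|an] := ltP 0 al.
    by rewrite gtr0_norm// divff// e1_1 mulr1.
  rewrite ler0_norm// invrN mulrN divff//.
  by rewrite -[_ * _]mulr1 -[X in _ * X]e1_1 -mulrA [e1 (-1) * _]mulrC e1VN mulr1.
apply: (@rapidly_decaying_solution_eq0 R g D (fun y => c0 + c1 * e1 (al * y)) c2 be `|al|^-1) => //.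
- by rewrite invr_gt0 normr_gt0.
- by move=> x; rewrite /D per.
- by move=> x; exact: normc_ge0.
- by move=> x; rewrite per.
- exact: continuous_trig3.
Qed.

Definition trig3 (c0 c1 c2 : R[i]) (l0 l1 l2 : R) (y : R) : R :=
  normc (c0 * e1 (l0 * y) + c1 * e1 (l1 * y) + c2 * e1 (l2 * y)).

Lemma trig3_rot c0 c1 c2 l0 l1 l2 :
  trig3 c0 c1 c2 l0 l1 l2 = trig3 c1 c2 c0 l1 l2 l0.
Proof. by apply/funext => y; rewrite /trig3; congr normc; ring. Qed.

Lemma trig3_factor c0 c1 c2 l0 l1 l2 y : trig3 c0 c1 c2 l0 l1 l2 y =
  normc (c0 + c1 * e1 ((l1 - l0) * y) + c2 * e1 ((l2 - l0) * y)).
Proof.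
rewrite /trig3 -[RHS]mul1r -(normc_e1 (l0 * y)) -normcM; congr normc.
rewrite !mulrDr !mulrA ![e1 _ * _]mulrC -!mulrA -!e1D.
by congr (_ + _ * e1 _ + _ * e1 _); ring.
Qed.

Lemma trig3_thin c0 c1 c2 l0 l1 l2 :
  l0 != l1 -> l0 != l2 -> l1 != l2 -> [|| c0 != 0, c1 != 0 | c2 != 0] ->
  thin_sublevels (trig3 c0 c1 c2 l0 l1 l2).
Proof.
move=> h01 h02 h12 /or3P[] nz.
- by rewrite trig3_rot; apply: three_exponentials_thin; rewrite // eq_sym.
- by rewrite 2!trig3_rot; apply: three_exponentials_thin; rewrite // eq_sym.
- exact: three_exponentials_thin.
Qed.

Lemma trig2_thin p0 p1 l0 l1 :
  l0 != l1 -> (p0 != 0) || (p1 != 0) -> thin_sublevels (trig3 p0 p1 0 l0 l1 l1).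
Proof.
move=> h01 nz.
have -> : trig3 p0 p1 0 l0 l1 l1 = trig3 p0 p1 0 l0 l1 (`|l0| + `|l1| + 1).
  by apply/funext => y; rewrite /trig3 !mul0r.
have n0 := normr_ge0 l0; have n1 := normr_ge0 l1.
have m0 := ler_norm l0; have m1 := ler_norm l1.
apply: trig3_thin => //; last by rewrite orbA nz.
  by rewrite lt_eqF//; lra.
by rewrite lt_eqF//; lra.
Qed.

(** Any of the three exponentials with a non-zero coefficient may be taken for
    [c2]; dividing by another one makes the remaining two a function [A] with
    one period, and [D] is constant. *)
Lemma unit_step_one_three g p (c0 c1 c2 : R[i]) (l0 l1 l2 : R) :
  (forall x, 0 <= g x) -> continuous g -> rapidly_decaying g ->
  l0 != l1 -> l0 != l2 -> l1 != l2 ->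
  [|| p != 0, c0 != 0, c1 != 0 | c2 != 0] ->
  (forall x, g (x + 1) * normc p = g x * trig3 c0 c1 c2 l0 l1 l2 x) ->
  forall x, g x = 0.
Proof.
move=> g0 cg dg h01 h02 h12 nz eqn.
have [cz|cnz] := boolP [|| c0 != 0, c1 != 0 | c2 != 0]; last first.
  move: cnz nz; rewrite !negb_or !negbK => /and3P[/eqP z0 /eqP z1 /eqP z2].
  rewrite z0 z1 z2 eqxx !orbF => pnz x.
  have := eqn (x - 1); rewrite subrK /trig3 z0 z1 z2 !mul0r !addr0 normc0 mulr0.
  by move/eqP; rewrite mulf_eq0 normc_eq0 (negbTE pnz) orbF => /eqP.
have tN := trig3_thin h01 h02 h12 cz.
have [pz|pnz] := eqVneq p 0.
  apply: vanish_off_thin cg tN _ => x.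
  by rewrite -eqn pz normc0 mulr0.
have wl k0 k1 k2 (n0 n1 n2 : R) : n0 != n1 -> n0 != n2 -> n1 != n2 -> k2 != 0 ->
    trig3 c0 c1 c2 l0 l1 l2 = trig3 k0 k1 k2 n0 n1 n2 -> forall x, g x = 0.
  move=> m01 m02 m12 k2z e.
  have a0 : n1 - n0 != 0 by rewrite subr_eq0 eq_sym.
  apply: (@one_period_core g p 0 k0 k1 k2 (n1 - n0) (n2 - n0)) => //.
  - have -> : (fun y => normc (p + 0 * e1 ((n1 - n0) * y))) = trig3 p 0 0 0 1 1.
      by apply/funext => y; rewrite /trig3 !mul0r e10 mulr1 !addr0.
    by apply: trig2_thin; rewrite ?pnz// eq_sym oner_eq0.
  - rewrite (_ : (fun y => _) = trig3 k0 k1 k2 n0 n1 n2); first by rewrite -e.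
    by apply/funext => y; rewrite trig3_factor.
  - by move=> x; rewrite mul0r addr0 eqn e trig3_factor.
case/or3P: cz => kz.
- by apply: (wl c1 c2 c0 l1 l2 l0); rewrite // ?(trig3_rot c0)// eq_sym.
- by apply: (wl c2 c0 c1 l2 l0 l1); rewrite // ?(trig3_rot c0) ?(trig3_rot c1)// eq_sym.
- exact: (wl c0 c1 c2 l0 l1 l2).
Qed.

(** Here [D] imposes the period, and [A] is constant once a suitable phase is
    divided out of [N]. *)
Lemma unit_step_two_two g (p0 p1 c0 c2 : R[i]) (k0 k1 l0 l2 : R) :
  (forall x, 0 <= g x) -> continuous g -> rapidly_decaying g ->
  k0 != k1 -> l0 != l2 ->
  [|| p0 != 0, p1 != 0, c0 != 0 | c2 != 0] ->
  (forall x, g (x + 1) * trig3 p0 p1 0 k0 k1 k1 x = g x * trig3 c0 c2 0 l0 l2 l2 x) ->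
  forall x, g x = 0.
Proof.
move=> g0 cg dg k01 l02 nz eqn.
have [cz|cnz] := boolP ((c0 != 0) || (c2 != 0)); last first.
  have pz : (p0 != 0) || (p1 != 0).
    by move: cnz nz; rewrite negb_or !negbK => /andP[/eqP -> /eqP ->];
      rewrite eqxx !orbF.
  have cg1 : continuous (fun x : R => g (x + 1)).
    move=> x; apply: (@continuous_comp _ _ _ (fun x : R => x + 1) g); last exact: cg.
    by apply: cvgD; [exact: cvg_id|exact: cvg_cst].
  have h := vanish_off_thin cg1 (trig2_thin k01 pz).
  move=> x; rewrite -[x](subrK 1); apply: h => {}x.
  rewrite eqn; move: cnz; rewrite negb_or !negbK => /andP[/eqP -> /eqP ->].
  by rewrite /trig3 !mul0r !addr0 normc0 mulr0.
have [pz|pnz] := boolP ((p0 != 0) || (p1 != 0)); last first.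
  apply: vanish_off_thin cg (trig2_thin l02 cz) _ => x.
  rewrite -eqn; move: pnz; rewrite negb_or !negbK => /andP[/eqP -> /eqP ->].
  by rewrite /trig3 !mul0r !addr0 normc0 mulr0.
have a0 : k1 - k0 != 0 by rewrite subr_eq0 eq_sym.
have wl m0 m2 (n0 n2 : R) : n0 != n2 -> m2 != 0 ->
    trig3 c0 c2 0 l0 l2 l2 = trig3 m0 m2 0 n0 n2 n2 -> forall x, g x = 0.
  move=> n02 mz e.
  apply: (@one_period_core g p0 p1 m0 0 m2 (k1 - k0) (n2 - n0)) => //.
  - rewrite (_ : (fun y => _) = trig3 p0 p1 0 k0 k1 k1); first exact: trig2_thin.
    by apply/funext => y; rewrite trig3_factor mul0r addr0.
  - rewrite (_ : (fun y => _) = trig3 m0 m2 0 n0 n2 n2).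
      by apply: trig2_thin => //; rewrite mz orbT.
    by apply/funext => y; rewrite trig3_factor !mul0r !addr0.
  - move=> x; have := eqn x; rewrite e !trig3_factor !mul0r !addr0.
    by move=> ->.
have [c2z|c2nz] := eqVneq c2 0.
  apply: (wl c2 c0 l2 l0); first by rewrite eq_sym.
    by move: cz; rewrite c2z eqxx orbF.
  by apply/funext => y; rewrite /trig3 !mul0r !addr0 addrC.
exact: (wl c0 c2 l0 l2).
Qed.

Local Close Scope classical_set_scope.
Local Open Scope set_scope.

Lemma cards3_elim (T : finType) (A : {set T}) : #|A| = 3%N ->
  exists x y z, [/\ x != y, x != z, y != z & A = [set x; y; z]].
Proof.
move=> A3; have /card_gt2P[x [y [z [[xA yA zA] [xy yz zx]]]]] : (2 < #|A|)%N by rewrite A3.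
exists x, y, z; split => //; first by rewrite eq_sym.
apply/esym/eqP; rewrite eqEcard A3 -finset.setUA cardsU1 cards2 !inE negb_or xy eq_sym zx yz /=.
apply/andP; split => //; apply/fintype.subsetP => t; rewrite !inE => /or3P[] /eqP -> //.
Qed.

Lemma sum_set2 (T : finType) (V : nmodType) (G : T -> V) (x y : T) : x != y ->
  \sum_(j in [set x; y]) G j = G x + G y.
Proof. by move=> xy; rewrite big_setU1 ?inE// big_set1. Qed.

Lemma sum_set3 (T : finType) (V : nmodType) (G : T -> V) (x y z : T) :
  x != y -> x != z -> y != z ->
  \sum_(j in [set x; y; z]) G j = G x + G y + G z.
Proof.
move=> xy xz yz; rewrite -finset.setUA big_setU1 ?inE ?negb_or ?xy ?xz//.
by rewrite /= big_setU1 ?inE// big_set1 /= addrA.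
Qed.

(** Only the translates by [a] and [b] occur; the change of variable
    [x = (a - b) * y - b] turns them into [g (y + 1)] and [g y]. *)
Lemma vertical_lines_independent F (a b : R) (al et : 'I_4 -> R) (d : 'I_4 -> R[i]) :
  continuous (fun x => normc (F x)) -> rapidly_decaying (fun x => normc (F x)) ->
  a != b -> (forall j, al j = a \/ al j = b) ->
  injective (fun j => (al j, et j)) ->
  #|[set j | al j == a]| = 1%N \/ #|[set j | al j == a]| = 2%N ->
  (exists j, d j != 0) ->
  (forall x, \sum_(j < 4) d j * F (x + al j) * e1 (et j * x) = 0) ->
  forall x, F x = 0.
Proof.
move=> cF dF ab alP inj cardA dn0 rel.
pose h := a - b; have h0 : h != 0 by rewrite subr_eq0.
pose g y := normc (F (h * y)).
have g0 y : 0 <= g y by exact: normc_ge0.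
have cg : continuous g.
  move=> y; apply: (@continuous_comp _ _ _ (fun y : R => h * y) (fun x => normc (F x))).
    by apply: cvgM; [exact: cvg_cst|exact: cvg_id].
  exact: cF.
have dg : rapidly_decaying g.
  move=> K; have [M hM] := dF K; exists (`|h| ^- K * M) => y.
  rewrite ler_pdivlMl ?exprn_gt0 ?normr_gt0// mulrA -exprMn -normrM; exact: hM.
suff gz : forall y, g y = 0.
  move=> x; have := gz (h^-1 * x); rewrite /g mulrA mulfV// mul1r => /eqP.
  by rewrite normc_eq0 => /eqP.
pose A := [set j | al j == a].
pose dd j := d j * e1 (- (et j * b)); pose ee j := et j * h.
have ddn0 j : d j != 0 -> dd j != 0.
  by move=> dj; rewrite mulf_neq0// e1_neq0.
have ealE j y : e1 (et j * (h * y - b)) = e1 (- (et j * b)) * e1 (ee j * y).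
  by rewrite -e1D; congr e1; rewrite /ee; ring.
have relA y : F (h * (y + 1)) * (\sum_(j in A) dd j * e1 (ee j * y)) =
    - (F (h * y) * (\sum_(j in ~: A) dd j * e1 (ee j * y))).
  apply/eqP; rewrite -addr_eq0 -[X in _ == X](rel (h * y - b)).
  rewrite [X in _ == X](bigID (mem A)) /= !mulr_sumr; apply/eqP; congr (_ + _).
    apply: eq_bigr => j; rewrite inE => /eqP ->; rewrite ealE /dd.
    have -> : h * y - b + a = h * (y + 1) by rewrite /h; ring.
    by ring.
  apply: eq_big => [j|j]; first by rewrite !inE.
  rewrite !inE => ja; have -> : al j = b by case: (alP j) ja => -> //; rewrite eqxx.
  by rewrite ealE /dd subrK; ring.
have mod_rel y : g (y + 1) * normc (\sum_(j in A) dd j * e1 (ee j * y)) =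
    g y * normc (\sum_(j in ~: A) dd j * e1 (ee j * y)).
  by rewrite /g -!normcM relA normc_opp.
have eeA i j : i != j -> al i = al j -> ee i != ee j.
  move=> ij e; apply: contra ij => /eqP /(mulIf h0) e'.
  by apply/eqP; apply: inj; rewrite e e'.
have ofA i : i \in A -> al i = a by rewrite inE => /eqP.
have ofCA i : i \in ~: A -> al i = b.
  by rewrite !inE; case: (alP i) => -> //; rewrite eqxx.
have cardC := cardsC A; rewrite card_ord in cardC.
have splitA i : (i \in A) || (i \in ~: A) by rewrite !inE orbN.
have [j dj] := dn0; have {}dj := ddn0 _ dj.
case: cardA => cA; rewrite -/A in cA; rewrite cA in cardC.
  have /eqP/cards1P[i0 Ai0] := cA.
  have [i1 [i2 [i3 [n12 n13 n23 CA]]]] : exists x y z, [/\ x != y, x != z, y != z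
      & ~: A = [set x; y; z]] by apply: cards3_elim; lia.
  have [m1 m2 m3] : [/\ al i1 = b, al i2 = b & al i3 = b].
    by split; apply: ofCA; rewrite CA !inE eqxx ?orbT.
  apply: (@unit_step_one_three g (dd i0) (dd i1) (dd i2) (dd i3)
      (ee i1) (ee i2) (ee i3)) => //.
  - by apply: eeA => //; rewrite m1.
  - by apply: eeA => //; rewrite m1.
  - by apply: eeA => //; rewrite m2.
  - have := splitA j; rewrite CA Ai0 !inE -!orbA => /or4P[] /eqP e;
      by rewrite -e dj ?orbT.
  - move=> y; have := mod_rel y; rewrite Ai0 -Ai0 CA Ai0 big_set1 sum_set3//.
    by rewrite normcM normc_e1 mulr1.
have /eqP/cards2P[i0 [i1 [n01 Ai]]] := cA.
have /eqP/cards2P[i2 [i3 [n23 CA]]] : #|~: A| = 2%N by lia.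
apply: (@unit_step_two_two g (dd i0) (dd i1) (dd i2) (dd i3)
      (ee i0) (ee i1) (ee i2) (ee i3)) => //.
- by apply: eeA => //; rewrite !ofA// Ai !inE eqxx ?orbT.
- by apply: eeA => //; rewrite !ofCA// CA !inE eqxx ?orbT.
- have := splitA j; rewrite CA Ai !inE -!orbA => /or4P[] /eqP e;
    by rewrite -e dj ?orbT.
- move=> y; have := mod_rel y; rewrite CA Ai !sum_set2//.
  by rewrite /trig3 !mul0r !addr0.
Qed.

End Vertical.

(** * Antiderivatives of decaying functions *)

Section RealIntegral.
Variable R : realType.
Implicit Types (u W F : R -> R).

Lemma zero_derivative_const F (a : R) :
  (forall x, a <= x -> is_derive x 1 F 0) -> forall x y, a <= x -> a <= y -> F x = F y.
Proof.
move=> dF x y; wlog xy : x y / x <= y => [hw ax ay|ax ay].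
  by have [|/ltW] := leP x y => h; [apply: hw|apply/esym/hw].
have [c _ /eqP] := mean_value (df := fun=> 0) xy (fun z hz => dF z (le_trans ax (andP hz).1)).
by rewrite mul0r subr_eq0 => /eqP.
Qed.

(** Antiderivatives on the half-lines [[- n, +oo[] agree once they vanish at 0. *)
Lemma global_antiderivative W : continuous W ->
  exists F : R -> R, forall x : R, is_derive x 1 F (W x).
Proof.
move=> cW.
have /choice[Fn dFn] := fun n : nat => @antiderivative R W (- n%:R) cW.
pose idx (x : R) := (Num.trunc `|x|).+1.
have idxP x : - (idx x)%:R <= x.
  have /andP[_ h] := truncn_itv (normr_ge0 x).
  by rewrite lerNl; apply: le_trans (ltW h); rewrite -normrN ler_norm.
pose F x := Fn (idx x) x - Fn (idx x) 0.
have agree (n m : nat) x : (n <= m)%N -> - n%:R <= x ->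
    Fn n x - Fn n 0 = Fn m x - Fn m 0.
  move=> nm nx.
  have d0 (z : R) : - n%:R <= z -> is_derive z 1 (fun y => Fn n y - Fn m y) 0.
    move=> nz; rewrite -(subrr (W z)); apply: is_deriveB; first exact: dFn.
    by apply: dFn; apply: le_trans nz; rewrite lerN2 ler_nat.
  have n0 : - n%:R <= 0 :> R by rewrite oppr_le0.
  have := zero_derivative_const d0 nx n0; lra.
have FE (n : nat) x : - n%:R <= x -> F x = Fn n x - Fn n 0.
  move=> nx; rewrite /F; case: (leqP n (idx x)) => [h|/ltnW h].
    by rewrite (agree n (idx x)).
  by rewrite (agree (idx x) n).
exists F => x.
pose N := (idx x).+1.
have dN : is_derive x 1 (fun y => Fn N y - Fn N 0) (W x).
  rewrite -[W x]subr0; apply: is_deriveB; apply: dFn.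
  by apply: le_trans (idxP x); rewrite lerN2 ler_nat.
apply: near_eq_is_derive dN.
apply/nbhs_ballP; exists 1 => //= y; rewrite /ball /= ltr_norml => /andP[h2 h3].
apply/esym/FE; have := idxP x; rewrite /N -natr1 => h1; lra.
Qed.

Definition tends_at_infinity (F : R -> R) (l0 l1 : R) : Prop :=
  forall ep : R, 0 < ep -> exists X : R, forall x, X <= x ->
    `|F (- x) - l0| <= ep /\ `|F x - l1| <= ep.

Lemma monotone_bounded_limit F (B : R) :
  (forall x y, x <= y -> F x <= F y) -> (forall x, `|F x| <= B) ->
  exists l, forall ep : R, 0 < ep -> exists X, forall x, X <= x -> `|F x - l| <= ep.
Proof.
move=> mono bnd.
have hs : has_sup (range F).
  split; first by exists (F 0), 0.
  exists B => _ [x _ <-]; exact: le_trans (ler_norm _) (bnd x).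
exists (sup (range F)) => ep ep0.
have [_ [X _ <-] hX] := sup_adherent ep0 hs.
exists X => x Xx; rewrite distrC ger0_norm.
  by have := mono _ _ Xx; lra.
by rewrite subr_ge0; apply: (ub_le_sup hs.2); exists x.
Qed.

Lemma monotone_bounded_limits F (B : R) :
  (forall x y, x <= y -> F x <= F y) -> (forall x, `|F x| <= B) ->
  exists l0 l1, tends_at_infinity F l0 l1.
Proof.
move=> mono bnd.
have [l1 h1] := monotone_bounded_limit mono bnd.
have [l0 h0] : exists l, forall ep : R, 0 < ep ->
    exists X, forall x, X <= x -> `|- F (- x) - l| <= ep.
  apply: (@monotone_bounded_limit (fun x => - F (- x)) B) => [x y xy|x].
    by rewrite lerN2 mono// lerN2.
  by rewrite normrN.
exists (- l0), l1 => ep ep0.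
have [X0 H0] := h0 _ ep0; have [X1 H1] := h1 _ ep0.
exists (Num.max X0 X1) => x; rewrite ge_max => /andP[x0 x1]; split; last exact: H1.
by rewrite opprK -normrN opprD; exact: H0.
Qed.

Lemma tends_at_infinityB F G (a b c d : R) :
  tends_at_infinity F a b -> tends_at_infinity G c d ->
  tends_at_infinity (fun x => F x - G x) (a - c) (b - d).
Proof.
move=> hF hG ep ep0; have e2 : 0 < ep / 2 by rewrite divr_gt0.
have [X HX] := hF _ e2; have [Y HY] := hG _ e2.
exists (Num.max X Y) => x; rewrite ge_max => /andP[xX xY].
have [f0 f1] := HX _ xX; have [g0' g1'] := HY _ xY.
move: f0 f1 g0' g1'; rewrite !ler_norml.
move=> /andP[? ?] /andP[? ?] /andP[? ?] /andP[? ?].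
by split; apply/andP; split; lra.
Qed.

(** Compare [F] with [M * atan] and [- M * atan]. *)
Lemma decaying_variation u F (M : R) :
  (forall x, `|u x| <= M / (1 + x ^+ 2)) -> (forall x : R, is_derive x 1 F (u x)) ->
  forall x y, x <= y -> `|F y - F x| <= M * (atan y - atan x).
Proof.
move=> hu dF x y xy.
have datan (s z : R) : is_derive z 1 (fun t => F t + s * atan t) (u z + s * (1 + z ^+ 2)^-1).
  apply: is_deriveD; apply: (@is_deriveZ _ _ _ (@atan R)).
have [c1 _ h1] := mean_value xy (fun z _ => datan M z).
have [c2 _ h2] := mean_value xy (fun z _ => datan (- M) z).
have := hu c1; rewrite ler_norml => /andP[u1 _].
have := hu c2; rewrite ler_norml => /andP[_ u2].
have k1 : 0 <= (u c1 + M / (1 + c1 ^+ 2)) * (y - x) by rewrite mulr_ge0 ?subr_ge0//; lra.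
have k2 : 0 <= - (u c2 + - M / (1 + c2 ^+ 2)) * (y - x).
  by rewrite mulr_ge0 ?subr_ge0//; rewrite mulNr; lra.
rewrite -h1 in k1; rewrite mulNr -h2 in k2.
rewrite ler_norml; apply/andP; split; lra.
Qed.

Lemma decaying_antiderivative u (M : R) : continuous u ->
  (forall x, `|u x| <= M / (1 + x ^+ 2)) ->
  exists F v, (forall x : R, is_derive x 1 F (u x)) /\ tends_at_infinity F 0 v.
Proof.
move=> cu hu; have [F0 dF0] := global_antiderivative cu.
have M0 : 0 <= M by have := hu 0; rewrite expr0n addr0 divr1; apply: le_trans.
have var := decaying_variation hu dF0.
have ab (x : R) : `|atan x| <= pi.
  have := atan_ltpi2 x; have := atan_gtNpi2 x; have := pi_gt0 R.
  by rewrite ler_norml => *; apply/andP; split; lra.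
have [a0 [a1 ha]] : exists l0 l1, tends_at_infinity (fun x => M * atan x) l0 l1.
  apply: (@monotone_bounded_limits _ (M * pi)) => [x y xy|x].
    by rewrite ler_wpM2l// le_atan.
  by rewrite normrM ger0_norm// ler_wpM2l.
have [g0 [g1 hg]] : exists l0 l1, tends_at_infinity (fun x => F0 x + M * atan x) l0 l1.
  apply: (@monotone_bounded_limits _ (`|F0 0| + 2 * M * pi)) => [x y xy|x].
    by have := var _ _ xy; rewrite ler_norml => /andP[? ?]; lra.
  have h : `|F0 x - F0 0| <= M * pi.
    have [x0|/ltW x0] := leP 0 x.
      apply: le_trans (var _ _ x0) _; rewrite atan0 subr0 ler_wpM2l//.
      exact: le_trans (ler_norm _) (ab x).
    rewrite distrC; apply: le_trans (var _ _ x0) _; rewrite atan0 sub0r ler_wpM2l//.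
    by apply: le_trans (ab x); rewrite -normrN ler_norm.
  have h2 : `|M * atan x| <= M * pi by rewrite normrM ger0_norm// ler_wpM2l.
  have e : F0 x + M * atan x = F0 0 + ((F0 x - F0 0) + M * atan x) by ring.
  rewrite e; apply: le_trans (ler_normD _ _) _.
  have := ler_normD (F0 x - F0 0) (M * atan x); lra.
have hF := tends_at_infinityB hg ha.
exists (fun x => F0 x - (g0 - a0)), (g1 - a1 - (g0 - a0)); split.
  by move=> x; rewrite -[u x]subr0; apply: is_deriveB.
move=> ep ep0; have [X HX] := hF _ ep0; exists X => x xX.
have [k0 k1] := HX _ xX; rewrite !addrK in k0 k1.
split; first by rewrite subr0.
have -> : F0 x - (g0 - a0) - (g1 - a1 - (g0 - a0)) = F0 x - (g1 - a1) by ring.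
exact: k1.
Qed.

Lemma decaying_integral_bound u F (M v : R) :
  (forall x, `|u x| <= M / (1 + x ^+ 2)) -> (forall x : R, is_derive x 1 F (u x)) ->
  tends_at_infinity F 0 v -> `|v| <= M * pi.
Proof.
move=> hu dF hF.
have M0 : 0 <= M by have := hu 0; rewrite expr0n addr0 divr1; apply: le_trans.
apply/ler_addgt0Pr => ep ep0; have e2 : 0 < ep / 2 by rewrite divr_gt0.
have [X HX] := hF _ e2; pose x := Num.max X 0.
have [k0 k1] : `|F (- x) - 0| <= ep / 2 /\ `|F x - v| <= ep / 2.
  by apply: HX; rewrite le_max lexx.
have x0 : 0 <= x by rewrite le_max lexx orbT.
have xx : - x <= x by rewrite (le_trans _ x0)// oppr_le0.
have h := decaying_variation hu dF xx.
have hpi : M * (atan x - atan (- x)) <= M * pi.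
  by rewrite ler_wpM2l//; have := atan_ltpi2 x; have := atan_gtNpi2 (- x); lra.
move: h k0 k1; rewrite subr0 !ler_norml => /andP[? ?] /andP[? ?] /andP[? ?].
apply/andP; split; lra.
Qed.

End RealIntegral.

(** * Integrals over the line *)

Section ComplexIntegral.
Variable R : realType.
Implicit Types (u w : R -> R) (h k dh dk : R -> R[i]).

(** The improper integral as a relation between a function and a value: for
    antiderivatives linearity, translation invariance and integration by parts
    are immediate. *)
Definition has_rintegral u (v : R) : Prop :=
  exists F, (forall x : R, is_derive x 1 F (u x)) /\ tends_at_infinity F 0 v.

Lemma has_rintegral_lin u w (a b v z : R) :
  has_rintegral u v -> has_rintegral w z ->
  has_rintegral (fun x => a * u x + b * w x) (a * v + b * z).
Proof.
move=> [F [dF lF]] [G [dG lG]].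
exists (fun x => a * F x + b * G x); split.
  by move=> x; apply: is_deriveD.
move=> ep ep0; pose d := ep / (2 * (1 + `|a| + `|b|)).
have c0 : 0 < 1 + `|a| + `|b| by rewrite -addrA ltr_wpDr// addr_ge0.
have d0 : 0 < d by rewrite divr_gt0// mulr_gt0.
have dE : (1 + `|a| + `|b|) * d = ep / 2 by rewrite /d; field; rewrite gt_eqF.
have [X HX] := lF _ d0; have [Y HY] := lG _ d0.
exists (Num.max X Y) => x; rewrite ge_max => /andP[xX xY].
have [f0 f1] := HX _ xX; have [g0 g1] := HY _ xY.
have bound (s t s' t' : R) : `|s - s'| <= d -> `|t - t'| <= d ->
    `|a * s + b * t - (a * s' + b * t')| <= ep.
  move=> hs ht; have -> : a * s + b * t - (a * s' + b * t') = a * (s - s') + b * (t - t') by ring.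
  apply: le_trans (ler_normD _ _) _; rewrite !normrM.
  have h1 : `|a| * `|s - s'| <= `|a| * d by rewrite ler_wpM2l.
  have h2 : `|b| * `|t - t'| <= `|b| * d by rewrite ler_wpM2l.
  rewrite !mulrDl in dE; lra.
by split; [have := bound _ _ _ _ f0 g0; rewrite !mulr0 addr0|exact: bound].
Qed.

Lemma has_rintegral_ext u w (v : R) : u =1 w -> has_rintegral u v -> has_rintegral w v.
Proof. by move=> e [F [dF lF]]; exists F; split => // x; rewrite -e. Qed.

Lemma has_rintegral_unique u (v z : R) :
  has_rintegral u v -> has_rintegral u z -> v = z.
Proof.
move=> hv hz.
have [F [dF lF]] := has_rintegral_lin 1 (-1) hv hz.
have zero x : `|1 * u x + -1 * u x| <= 0 / (1 + x ^+ 2).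
  by rewrite mul0r mul1r mulN1r subrr normr0.
have := decaying_integral_bound zero dF lF.
rewrite mul0r normr_le0 mul1r mulN1r subr_eq0 => /eqP //.
Qed.

Lemma has_rintegral_shift u (v t : R) :
  has_rintegral u v -> has_rintegral (fun x => u (x + t)) v.
Proof.
move=> [F [dF lF]]; exists (fun x => F (x + t)); split.
  by move=> x; apply: is_derive_shift_arg.
move=> ep ep0; have [X HX] := lF _ ep0; exists (X + `|t|) => x xX.
have := ler_norm t; have := ler_norm (- t); rewrite normrN => t1 t2.
have [_ h1] := HX (x + t) ltac:(lra).
have [h0 _] := HX (x - t) ltac:(lra).
by split => //; rewrite (_ : - x + t = - (x - t)) //; ring.
Qed.

(** Derivatives are taken on real and imaginary parts, as for [smooth]. *)
Definition has_cderiv h dh : Prop := forall x : R,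
  is_derive x 1 (fun t => complex.Re (h t)) (complex.Re (dh x)) /\
  is_derive x 1 (fun t => complex.Im (h t)) (complex.Im (dh x)).

Definition has_integral h (v : R[i]) : Prop :=
  has_rintegral (fun x => complex.Re (h x)) (complex.Re v) /\
  has_rintegral (fun x => complex.Im (h x)) (complex.Im v).

Lemma has_integral_ext h k v : h =1 k -> has_integral h v -> has_integral k v.
Proof.
by move=> e [hr hi]; split; [apply: has_rintegral_ext hr|apply: has_rintegral_ext hi];
  move=> x; rewrite e.
Qed.

Lemma has_integral_unique h v z : has_integral h v -> has_integral h z -> v = z.
Proof.
move=> [r1 i1] [r2 i2]; apply/eqP; rewrite eq_complex.
by rewrite (has_rintegral_unique r1 r2) (has_rintegral_unique i1 i2) !eqxx.
Qed.

Lemma has_integral_scale (c : R[i]) h v :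
  has_integral h v -> has_integral (fun x => c * h x) (c * v).
Proof.
move=> [hr hi]; split.
  have := has_rintegral_lin (complex.Re c) (- complex.Im c) hr hi.
  rewrite mulNr; case: c v {hr hi} => [a b] [p q] /=; apply: has_rintegral_ext => x.
  by case: (h x) => ? ? /=; rewrite mulNr.
have := has_rintegral_lin (complex.Re c) (complex.Im c) hi hr.
case: c v {hr hi} => [a b] [p q] /=; apply: has_rintegral_ext => x.
by case: (h x).
Qed.

Lemma has_integralD h k v z :
  has_integral h v -> has_integral k z -> has_integral (fun x => h x + k x) (v + z).
Proof.
move=> [hr hi] [kr ki]; split.
  have := has_rintegral_lin 1 1 hr kr; rewrite !mul1r.
  case: v z {hr hi kr ki} => [a b] [p q] /=; apply: has_rintegral_ext => x.
  by rewrite !mul1r; case: (h x) (k x) => [? ?] [? ?].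
have := has_rintegral_lin 1 1 hi ki; rewrite !mul1r.
case: v z {hr hi kr ki} => [a b] [p q] /=; apply: has_rintegral_ext => x.
by rewrite !mul1r; case: (h x) (k x) => [? ?] [? ?].
Qed.

Lemma has_integral_shift h v (t : R) :
  has_integral h v -> has_integral (fun x => h (x + t)) v.
Proof. by move=> [hr hi]; split; [exact: has_rintegral_shift hr|exact: has_rintegral_shift hi]. Qed.

Lemma has_integral0 : has_integral (fun=> 0) 0.
Proof.
have h : has_rintegral (fun=> 0) 0.
  exists (fun=> 0); split; first by move=> x; exact: is_derive_cst.
  by move=> ep ep0; exists 0 => x _; rewrite subrr normr0 ltW.
by split.
Qed.

Lemma has_integral_sum (n : nat) (H : 'I_n -> R -> R[i]) (v : 'I_n -> R[i]) :
  (forall i, has_integral (H i) (v i)) ->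
  has_integral (fun x => \sum_(i < n) H i x) (\sum_(i < n) v i).
Proof.
elim: n H v => [|n IH] H v hH.
  rewrite big_ord0; apply: has_integral_ext has_integral0 => x.
  by rewrite big_ord0.
rewrite big_ord_recr /=.
have := has_integralD (IH (fun i => H (widen_ord (leqnSn n) i))
   (fun i => v (widen_ord (leqnSn n) i)) (fun i => hH _)) (hH ord_max).
by apply: has_integral_ext => x; rewrite big_ord_recr.
Qed.

Lemma le_quadratic_decay h (M : R) :
  (forall x, normc (h x) * (1 + x ^+ 2) <= M) ->
  (forall x, `|complex.Re (h x)| <= M / (1 + x ^+ 2)) /\
  (forall x, `|complex.Im (h x)| <= M / (1 + x ^+ 2)).
Proof.
move=> hM; split=> x; have p : 0 < 1 + x ^+ 2 by rewrite ltr_pwDl// sqr_ge0.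
  by rewrite ler_pdivlMr// (le_trans _ (hM x))// ler_wpM2r ?(ltW p)// normc_Re_le.
by rewrite ler_pdivlMr// (le_trans _ (hM x))// ler_wpM2r ?(ltW p)// normc_Im_le.
Qed.

Lemma quadratic_decay_tends u (M : R) : (forall x, `|u x| <= M / (1 + x ^+ 2)) ->
  tends_at_infinity u 0 0.
Proof.
move=> hu ep ep0; exists (M / ep + 1) => x xX.
have M0 : 0 <= M by have := hu 0; rewrite expr0n addr0 divr1; apply: le_trans.
have q0 : 0 <= M / ep by rewrite divr_ge0// ltW.
have x1 : 1 <= x by lra.
have p : 0 < 1 + x ^+ 2 by rewrite ltr_pwDl// sqr_ge0.
have bnd : M / (1 + x ^+ 2) <= ep.
  rewrite ler_pdivrMr// mulrC -ler_pdivrMr//.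
  have : x * 1 <= x * x by rewrite ler_wpM2l//; lra.
  rewrite expr2; lra.
rewrite !subr0; split; apply: le_trans bnd; last exact: hu.
by have := hu (- x); rewrite sqrrN.
Qed.

Lemma has_integral_derivative h dh (M : R) : has_cderiv h dh ->
  (forall x, normc (h x) * (1 + x ^+ 2) <= M) -> has_integral dh 0.
Proof.
move=> dhP hM; have [r i] := le_quadratic_decay hM.
split.
  exists (fun t => complex.Re (h t)); split; last exact: quadratic_decay_tends r.
  by move=> x; case: (dhP x).
exists (fun t => complex.Im (h t)); split; last exact: quadratic_decay_tends i.
by move=> x; case: (dhP x).
Qed.

Lemma is_derive_everywhere_continuous u du :
  (forall x : R, is_derive x 1 u (du x)) -> continuous u.
Proof.
move=> d x; apply: differentiable_continuous; apply/derivable1_diffP.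
by case: (d x).
Qed.

Lemma has_cderiv_continuous h dh : has_cderiv h dh ->
  continuous (fun x => complex.Re (h x)) /\ continuous (fun x => complex.Im (h x)).
Proof.
move=> d; split.
  by apply: (@is_derive_everywhere_continuous _ (fun x => complex.Re (dh x))) => x; case: (d x).
by apply: (@is_derive_everywhere_continuous _ (fun x => complex.Im (dh x))) => x; case: (d x).
Qed.

Lemma integral_exists h dh (M : R) : has_cderiv h dh ->
  (forall x, normc (h x) * (1 + x ^+ 2) <= M) -> exists v, has_integral h v.
Proof.
move=> d hM; have [cr ci] := has_cderiv_continuous d.
have [r i] := le_quadratic_decay hM.
have [F [v [dF lF]]] := decaying_antiderivative cr r.
have [G [z [dG lG]]] := decaying_antiderivative ci i.
by exists (v +i* z); split; [exists F|exists G].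
Qed.

Lemma integral_bound h (M : R) v :
  (forall x, normc (h x) * (1 + x ^+ 2) <= M) -> has_integral h v ->
  normc v <= 2 * pi * M.
Proof.
move=> hM [[F [dF lF]] [G [dG lG]]]; have [r i] := le_quadratic_decay hM.
have := decaying_integral_bound r dF lF; have := decaying_integral_bound i dG lG.
have := normc_le_ReIm v; lra.
Qed.

Lemma has_cderivM h k dh dk : has_cderiv h dh -> has_cderiv k dk ->
  has_cderiv (fun x => h x * k x) (fun x => dh x * k x + h x * dk x).
Proof.
move=> dhP dkP x; have [hr hi] := dhP x; have [kr ki] := dkP x.
have E (a b : R[i]) : complex.Re (a * b) =
    complex.Re a * complex.Re b - complex.Im a * complex.Im b by case: a b => [? ?] [? ?].
have E' (a b : R[i]) : complex.Im (a * b) =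
    complex.Re a * complex.Im b + complex.Im a * complex.Re b by case: a b => [? ?] [? ?].
have RD (a b : R[i]) : complex.Re (a + b) = complex.Re a + complex.Re b by case: a b => [? ?] [? ?].
have ID (a b : R[i]) : complex.Im (a + b) = complex.Im a + complex.Im b by case: a b => [? ?] [? ?].
split.
  have := is_deriveB (is_deriveM hr kr) (is_deriveM hi ki).
  rewrite RD !E /GRing.scale /=.
  set d1 := (X in is_derive _ _ _ X -> _); set d2 := (X in _ -> is_derive _ _ _ X).
  have -> : d1 = d2 by rewrite /d1 /d2; ring.
  by congr is_derive; apply/funext => t /=; rewrite E.
have := is_deriveD (is_deriveM hr ki) (is_deriveM hi kr).
rewrite ID !E' /GRing.scale /=.
set d1 := (X in is_derive _ _ _ X -> _); set d2 := (X in _ -> is_derive _ _ _ X).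
have -> : d1 = d2 by rewrite /d1 /d2; ring.
by congr is_derive; apply/funext => t /=; rewrite E'.
Qed.

Lemma has_cderivD h k dh dk : has_cderiv h dh -> has_cderiv k dk ->
  has_cderiv (fun x => h x + k x) (fun x => dh x + dk x).
Proof.
move=> dhP dkP x; have [hr hi] := dhP x; have [kr ki] := dkP x.
have RD (a b : R[i]) : complex.Re (a + b) = complex.Re a + complex.Re b by case: a b => [? ?] [? ?].
have ID (a b : R[i]) : complex.Im (a + b) = complex.Im a + complex.Im b by case: a b => [? ?] [? ?].
split.
  rewrite RD; have := is_deriveD hr kr.
  by congr is_derive; apply/funext => t /=; rewrite RD.
rewrite ID; have := is_deriveD hi ki.
by congr is_derive; apply/funext => t /=; rewrite ID.
Qed.

Lemma has_cderiv_cst (c : R[i]) : has_cderiv (fun=> c) (fun=> 0).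
Proof. by move=> x; split; exact: is_derive_cst. Qed.

Lemma has_cderiv_id : has_cderiv (fun x => x%:C) (fun=> 1).
Proof. by move=> x; split; [exact: is_derive_id|exact: is_derive_cst]. Qed.

Lemma has_cderiv_ext h k dh dk : h =1 k -> dh =1 dk -> has_cderiv h dh -> has_cderiv k dk.
Proof.
by move=> e e' d x; have [r i] := d x; rewrite -e'; split;
  [move: r|move: i]; congr is_derive; apply/funext => t; rewrite e.
Qed.

Lemma has_cderiv_shift (h dh : R -> R[i]) (t : R) : has_cderiv h dh ->
  has_cderiv (fun x => h (x + t)) (fun x => dh (x + t)).
Proof.
move=> d x; have [r i] := d (x + t).
split; first exact: (@is_derive_shift_arg R (fun t => complex.Re (h t))).
exact: (@is_derive_shift_arg R (fun t => complex.Im (h t))).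
Qed.

Lemma has_cderiv_e1 (p dp : R -> R) : (forall x : R, is_derive x 1 p (dp x)) ->
  has_cderiv (fun x => e1 (p x)) (fun x => (0 +i* (2 * pi * dp x)) * e1 (p x)).
Proof.
move=> dP x.
have d2 : is_derive x 1 (fun t => 2 * pi * p t) (2 * pi * dp x).
  exact: (@is_deriveZ _ _ _ p (2 * pi)).
split.
  have := @is_derive1_comp R (@cos R) (fun t => 2 * pi * p t) x _ _ (is_derive_cos _) d2.
  by congr is_derive; rewrite /= mul0r sub0r mulNr mulrC.
have := @is_derive1_comp R (@sin R) (fun t => 2 * pi * p t) x _ _ (is_derive_sin _) d2.
by congr is_derive; rewrite /= mul0r add0r mulrC.
Qed.

End ComplexIntegral.

(** * The chirp transform *)

Section SchwartzSpan.
Variables (R : realType) (f : R -> R[i]).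
Hypothesis hf : schwartz f.

(** This family is closed under differentiation, and remains so when its
    members are multiplied by a quadratic chirp, whose derivative brings out a
    factor [x]; inductions on the order of decay run over the whole family. *)
Inductive schwartz_span : (R -> R[i]) -> Prop :=
| span_deriv (k : nat) : schwartz_span (cderive1n k f)
| spanD h k : schwartz_span h -> schwartz_span k -> schwartz_span (fun x => h x + k x)
| span_scale (c : R[i]) h : schwartz_span h -> schwartz_span (fun x => c * h x)
| span_mulx h : schwartz_span h -> schwartz_span (fun x => x%:C * h x).

Lemma span_self : schwartz_span f.
Proof.
have -> : f = cderive1n 0 f by apply/funext => x; rewrite /cderive1n /= /re_part /im_part; case: (f x).
exact: span_deriv.
Qed.

Lemma normCE (z : R[i]) : `|z| = (normc z)%:C.
Proof. by case: z. Qed.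

Lemma normcX (z : R[i]) n : normc (z ^+ n) = normc z ^+ n.
Proof.
elim: n => [|n IH]; first by rewrite !expr0 normc1.
by rewrite !exprS normcM IH.
Qed.

Lemma span_decay h : schwartz_span h -> rapidly_decaying (fun x => normc (h x)).
Proof.
elim=> [k|{}h k _ Ih _ Ik|c {}h _ Ih|{}h _ Ih] n.
- have [M hM] := hf.2 n k; exists M => x; have := hM x.
  by rewrite normCE lecR normcM normcX normc_real.
- have [M hM] := Ih n; have [M' hM'] := Ik n; exists (M + M') => x.
  apply: le_trans (lerD (hM x) (hM' x)); rewrite -mulrDr ler_wpM2l ?exprn_ge0//.
  exact: normcD_le.
- have [M hM] := Ih n; exists (normc c * M) => x.
  by rewrite normcM mulrCA ler_wpM2l ?normc_ge0.
- have [M hM] := Ih n.+1; exists M => x; have := hM x.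
  by rewrite normcM normc_real mulrA -exprSr.
Qed.

Lemma span_has_deriv h : schwartz_span h ->
  exists2 dh, schwartz_span dh & has_cderiv h dh.
Proof.
elim=> [k|{}h k _ [dh sh dhP] _ [dk sk dkP]|c {}h _ [dh sh dhP]|{}h sh0 [dh sh dhP]].
- exists (cderive1n k.+1 f); first exact: span_deriv.
  move=> x; have [dr di] := hf.1 k x.
  split.
    change (is_derive x 1 (derive1n k (re_part f)) (derive1n k.+1 (re_part f) x)).
    by rewrite (derive1nS (re_part f)) (derive1E (derive1n k (re_part f))); exact: derivableP.
  change (is_derive x 1 (derive1n k (im_part f)) (derive1n k.+1 (im_part f) x)).
  by rewrite (derive1nS (im_part f)) (derive1E (derive1n k (im_part f))); exact: derivableP.
- by exists (fun x => dh x + dk x); [exact: spanD|exact: has_cderivD].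
- exists (fun x => c * dh x); first exact: span_scale.
  apply: has_cderiv_ext (has_cderivM (has_cderiv_cst c) dhP) => // x.
  by rewrite mul0r add0r.
- exists (fun x => h x + x%:C * dh x); first by apply: spanD => //; exact: span_mulx.
  apply: (has_cderiv_ext _ _ (has_cderivM (@has_cderiv_id R) dhP)) => // x.
  by rewrite mul1r.
Qed.

End SchwartzSpan.

Section Decay.
Variable R : realType.

Lemma rapidly_decaying_poly (g : R -> R) (n : nat) : rapidly_decaying g ->
  (forall x, 0 <= g x) -> exists M, forall x, g x * (1 + x ^+ 2) ^+ n <= M.
Proof.
elim: n g => [|n IH] g dg g0.
  by have [M hM] := dg 0%N; exists M => x; have := hM x; rewrite !expr0 mulr1 mul1r.
have [] := IH (fun x => g x * (1 + x ^+ 2)).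
- move=> K; have [M hM] := dg K; have [M' hM'] := dg K.+2.
  exists (M + M') => x; apply: le_trans (lerD (hM x) (hM' x)).
  by rewrite -(real_normK (num_real x)) !exprS expr0; apply: eq_ler; ring.
- by move=> x; rewrite mulr_ge0// addr_ge0// sqr_ge0.
by move=> M hM; exists M => x; have := hM x; rewrite (exprS (1 + x ^+ 2)) mulrA.
Qed.

Lemma shift_weight (x t : R) : 1 + x ^+ 2 <= (2 + 2 * t ^+ 2) * (1 + (x + t) ^+ 2).
Proof.
have h1 := sqr_ge0 (x + t + t); have h2 := mulr_ge0 (sqr_ge0 t) (sqr_ge0 (x + t)).
have -> : (2 + 2 * t ^+ 2) * (1 + (x + t) ^+ 2) = 1 + x ^+ 2 +
  (1 + (x + t + t) ^+ 2 + 2 * (t ^+ 2 * (x + t) ^+ 2)) by ring.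
lra.
Qed.

End Decay.

Section Transform.
Variables (R : realType) (f : R -> R[i]) (sg : R).
Hypothesis hf : schwartz f.

Local Notation span := (schwartz_span f).

(** The integrand of the Fourier transform at [om] of [h] times the chirp
    [e1 (sg * x ^+ 2)]. *)
Definition chirped (h : R -> R[i]) (om : R) (x : R) : R[i] :=
  h x * e1 (sg * x ^+ 2 + - om * x).

Lemma normc_chirped h om x : normc (chirped h om x) = normc (h x).
Proof. by rewrite /chirped normcM normc_e1 mulr1. Qed.

Lemma chirped_deriv h : span h -> exists2 k, span k &
  forall om, has_cderiv (chirped h om)
    (fun x => chirped k om x + (0 +i* (- (2 * pi * om))) * chirped h om x).
Proof.
move=> sh; have [dh sdh dhP] := span_has_deriv hf sh.
exists (fun x => dh x + (0 +i* (4 * pi * sg)) * (x%:C * h x)).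
  by apply: spanD => //; apply: span_scale; apply: span_mulx.
move=> om.
have dp (x : R) : is_derive x 1 (fun x => sg * x ^+ 2 + - om * x) (sg * (2 * x) - om).
  have d1 : is_derive x 1 (fun x : R => x ^+ 2) (2 * x).
    have := @is_deriveX R _ (@id R) 2 x 1 1 (is_derive_id _ _).
    by congr is_derive; rewrite /GRing.scale /= expr1 mulr1.
  apply: is_deriveD.
  by rewrite -[X in is_derive _ _ _ X]mulr1; apply: (@is_deriveZ _ _ _ (@id R) (- om)).
apply: has_cderiv_ext (has_cderivM dhP (has_cderiv_e1 dp)) => // x.
rewrite /chirped.
have -> : (0 +i* (2 * pi * (sg * (2 * x) - om))) =
   (0 +i* (4 * pi * sg)) * x%:C + (0 +i* (- (2 * pi * om))) :> R[i].
  by apply/eqP; rewrite eq_complex /=; apply/andP; split; apply/eqP; ring.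
ring.
Qed.

Lemma span_poly h n : span h -> exists M, forall x, normc (h x) * (1 + x ^+ 2) ^+ n <= M.
Proof.
move=> sh; apply: rapidly_decaying_poly; first exact: span_decay sh.
by move=> x; exact: normc_ge0.
Qed.

Lemma chirped_integral h om : span h -> exists v, has_integral (chirped h om) v.
Proof.
move=> sh; have [k sk /(_ om) d] := chirped_deriv sh.
have [M hM] := span_poly 1 sh.
by apply: (integral_exists d (M := M)) => x; rewrite normc_chirped.
Qed.

(** Integration by parts, once for each power of [om]: the integral of the
    derivative given by [chirped_deriv] is zero. *)
Lemma chirped_integral_decay K h : span h ->
  exists M, forall om v, has_integral (chirped h om) v -> `|om| ^+ K * normc v <= M.
Proof.
elim: K h => [|K IH] h sh.
  have [M hM] := span_poly 1 sh.
  exists (2 * pi * M) => om v hv; rewrite expr0 mul1r.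
  by apply: integral_bound hv => x; rewrite normc_chirped.
have [k sk d] := chirped_deriv sh.
have [M hM] := IH k sk; exists M => om v hv.
have [M1 hM1] := span_poly 1 sh.
have [z hz] := chirped_integral om sk.
have h0 : has_integral (fun x => chirped k om x + (0 +i* (- (2 * pi * om))) * chirped h om x) 0.
  by apply: (has_integral_derivative (d om) (M := M1)) => x; rewrite normc_chirped.
have h1 := has_integralD hz (has_integral_scale (0 +i* (- (2 * pi * om))) hv).
have /esym/eqP := has_integral_unique h0 h1; rewrite addr_eq0 => /eqP zE.
have := hM om z hz; rewrite zE normc_opp normcM.
have -> : normc (0 +i* (- (2 * pi * om))) = 2 * pi * `|om| :> R.
  by rewrite /= expr0n add0r sqrtr_sqr normrN normrM ger0_norm// mulr_ge0// pi_ge0.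
apply: le_trans; rewrite exprSr -mulrA ler_wpM2l ?exprn_ge0// ler_wpM2r ?normc_ge0//.
by rewrite ler_peMl//; have := pi_ge2 R; lra.
Qed.

Lemma chirped_integral_lipschitz h : span h ->
  exists C, forall om om' v v', has_integral (chirped h om) v ->
    has_integral (chirped h om') v' -> normc (v - v') <= C * `|om - om'|.
Proof.
move=> sh; have [M hM] := span_poly 1 (span_mulx sh).
exists (4 * pi ^+ 2 * M) => om om' v v' hv hv'.
have hd := has_integralD hv (has_integral_scale (-1) hv').
rewrite mulN1r in hd.
have bnd x : normc (chirped h om x + -1 * chirped h om' x) * (1 + x ^+ 2)
    <= 2 * pi * `|om - om'| * M.
  have -> : chirped h om x + -1 * chirped h om' x = h x *
     (e1 (sg * x ^+ 2 + - om * x) - e1 (sg * x ^+ 2 + - om' * x)).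
    by rewrite /chirped; ring.
  rewrite normcM chord_e1B.
  have -> : sg * x ^+ 2 + - om * x - (sg * x ^+ 2 + - om' * x) = - ((om - om') * x) by ring.
  rewrite chordN.
  have p : 0 <= 1 + x ^+ 2 by rewrite addr_ge0// sqr_ge0.
  have h1 : normc (h x) * chord ((om - om') * x) <=
      2 * pi * `|om - om'| * (`|x| * normc (h x)).
    have := ler_wpM2l (normc_ge0 (h x)) (chord_le ((om - om') * x)).
    by rewrite normrM => hh; apply: le_trans hh _; apply: eq_ler; ring.
  apply: le_trans (ler_wpM2r p h1) _.
  have -> : 2 * pi * `|om - om'| * (`|x| * normc (h x)) * (1 + x ^+ 2) =
    2 * pi * `|om - om'| * (`|x| * normc (h x) * (1 + x ^+ 2)) by ring.
  rewrite ler_wpM2l//.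
    by rewrite !mulr_ge0// pi_ge0.
  by have := hM x; rewrite expr1 normcM normc_real.
by apply: le_trans (integral_bound bnd hd) _; apply: eq_ler; ring.
Qed.

End Transform.

(** * Uniqueness of the transform *)

Section Injectivity.
Variable R : realType.

Lemma bernoulli (t : R) (n : nat) : 0 <= t -> t <= 1 -> 1 - n%:R * t <= (1 - t) ^+ n.
Proof.
move=> t0 t1; elim: n => [|n IH]; first by rewrite mul0r subr0 expr0.
rewrite exprS -natr1; have t1' : 0 <= 1 - t by rewrite subr_ge0.
have := ler_wpM2l t1' IH; have : 0 <= n%:R * t ^+ 2 by rewrite mulr_ge0// sqr_ge0.
have -> : (1 - t) * (1 - n%:R * t) = 1 - (n%:R + 1) * t + n%:R * t ^+ 2 by ring.
lra.
Qed.

Lemma dual_bernoulli (y t : R) (n : nat) : 0 <= y -> 0 <= t -> y <= 1 - t ->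
  (1 + n%:R * t) * y ^+ n <= 1.
Proof.
move=> y0 t0 yt; elim: n => [|n IH]; first by rewrite mul0r addr0 expr0 mulr1.
apply: le_trans IH; rewrite exprS mulrA ler_wpM2r ?exprn_ge0//.
have nt : 0 <= n%:R * t by rewrite mulr_ge0.
have nn : 0 <= 1 + n.+1%:R * t by rewrite addr_ge0// mulr_ge0.
apply: le_trans (ler_wpM2l nn yt) _; rewrite -natr1.
have -> : (1 + (n%:R + 1) * t) * (1 - t) = 1 + n%:R * t - (t ^+ 2 + n%:R * t * t) by ring.
by rewrite gerBl addr_ge0 ?sqr_ge0// mulr_ge0.
Qed.

(** The weight [cos (x / L) ^+ (2 * k)] is concentrated at 0 on the scale [h]: with
    [k * (h / L) ^+ 2 = 1 / 2] it is at least 1/2 for [|x| <= h] and at most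
    [8 * h ^+ 2 / de ^+ 2] for [de <= |x| <= L].  If [u 0 > 0], the peak contributes
    at least a multiple of [h] to the integral, the range up to [L] subtracts
    [O(h ^+ 2)], and the range beyond [L] subtracts [O(L ^- 2)]. *)
Lemma peak_test (u : R -> R) (M : R) : continuous u ->
  (forall x, `|u x| * (1 + x ^+ 2) ^+ 2 <= M) ->
  (forall (et : R) (k : nat), has_rintegral (fun x => u x * (cos (et * x) ^+ 2) ^+ k) 0) ->
  u 0 <= 0.
Proof.
move=> cu uM test; rewrite leNgt; apply/negP => u0.
have p0 := pi_gt0 R; have p2 := pi_ge2 R.
have wpos (x : R) : 0 < 1 + x ^+ 2 by rewrite ltr_pwDl// sqr_ge0.
have M0 : 0 < M.
  by apply: lt_le_trans (uM 0); rewrite expr0n addr0 expr1n mulr1 normr_gt0 gt_eqF.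
pose c := u 0.
have [de de0 near] : exists2 de : R, 0 < de & forall x, `|x| <= de -> c / 2 <= u x.
  have c20 : 0 < c / 2 by rewrite divr_gt0.
  have /cvgrPdist_lt /(_ _ c20) /nbhs_ballP [e /= e0 he] := cu 0.
  exists (e / 2) => [|x xe]; first by rewrite divr_gt0.
  have : `|u 0 - u x| < c / 2.
    by apply: he; rewrite /ball /= sub0r normrN (le_lt_trans xe)// gtr_pMr// invf_lt1// ltr1n.
  by have := ler_norm (u 0 - u x); rewrite /c; lra.
(* [h] is chosen for the range [de <= |x| <= L] to cost at most [c * h / 8], and
   then [m] for the range beyond [L] to cost at most [c * h / 16] *)
pose h := Num.min de (c * de ^+ 2 / (64 * M * pi)).
have q0 : 0 < c * de ^+ 2 / (64 * M * pi) by rewrite divr_gt0 ?mulr_gt0 ?exprn_gt0.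
have h0 : 0 < h by rewrite lt_min de0.
have hde : h <= de by rewrite ge_min lexx.
have hq : h <= c * de ^+ 2 / (64 * M * pi) by rewrite ge_min lexx orbT.
pose Q := 4 * M * pi / (c * h ^+ 3).
have Q0 : 0 <= Q by rewrite divr_ge0 ?mulr_ge0 ?exprn_ge0// ltW.
pose m := (Num.trunc Q).+1.
have mQ : Q < m%:R by have /andP[_] := truncn_itv Q0.
have m1 : 1 <= m%:R :> R by rewrite ler1n.
pose L := 2 * h * m%:R; have L0 : 0 < L by rewrite !mulr_gt0// (lt_le_trans _ m1).
pose k := (2 * m ^ 2)%N.
have kE : k%:R = 2 * m%:R ^+ 2 :> R by rewrite natrM natrX.
have mn0 : m%:R != 0 :> R by rewrite pnatr_eq0.
have hn0 : h != 0 by rewrite gt_eqF.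
have kL : k%:R * (h ^+ 2 / L ^+ 2) = 1 / 2.
  by rewrite kE /L; field; rewrite mn0 hn0.
have [F [dF lF]] := test L^-1 k.
pose w x := (cos (L^-1 * x) ^+ 2) ^+ k.
have cs (t : R) : 0 <= cos t ^+ 2 <= 1.
  by rewrite sqr_ge0 /= -(cos2Dsin2 t) lerDl sqr_ge0.
have w01 x : 0 <= w x <= 1.
  have /andP[c0 c1] := cs (L^-1 * x).
  by rewrite /w exprn_ge0//= exprn_ile1.
pose tau := M * (8 * h ^+ 2 / de ^+ 2 + 1 / L ^+ 2).
have tau0 : 0 <= tau.
  by rewrite mulr_ge0 ?(ltW M0)// addr_ge0// divr_ge0 ?mulr_ge0 ?exprn_ge0// ltW.
have sq_le (a b : R) : 0 <= b -> `|a| <= b -> a ^+ 2 <= b ^+ 2.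
  by move=> b0 ab; rewrite -real_normK ?num_real// lerXn2r ?nnegrE.
have sq_ge (a b : R) : 0 <= b -> b <= `|a| -> b ^+ 2 <= a ^+ 2.
  by move=> b0 ab; rewrite -[a ^+ 2]real_normK ?num_real// lerXn2r ?nnegrE.
have peak x : `|x| <= h -> 1 / 2 <= w x.
  move=> xh.
  have t0 : 0 <= h ^+ 2 / L ^+ 2 by rewrite divr_ge0// sqr_ge0.
  have t1 : h ^+ 2 / L ^+ 2 <= 1.
    rewrite ler_pdivrMr ?exprn_gt0// mul1r lerXn2r ?nnegrE ?(ltW h0) ?(ltW L0)//.
    rewrite /L -[leLHS]mul1r -mulrA mulrCA mulrC.
    by rewrite ler_wpM2l ?(ltW h0)//; lra.
  have := bernoulli k t0 t1; rewrite kL => hb; apply: le_trans (_ : _ <= (1 - h ^+ 2 / L ^+ 2) ^+ k) _.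
    by apply: le_trans hb; lra.
  rewrite /w lerXn2r ?nnegrE ?subr_ge0//; first by case/andP: (cs (L^-1 * x)).
  rewrite cos2sin2 lerD2l lerN2.
  have := sq_le _ _ (normr_ge0 _) (norm_sin_le (L^-1 * x)); rewrite real_normK ?num_real//.
  move=> hs; apply: le_trans hs _; rewrite exprMn mulrC exprVn ler_wpM2r ?invr_ge0 ?sqr_ge0//.
  exact: sq_le (ltW h0) xh.
have away x : de <= `|x| -> `|x| <= L -> w x <= 8 * h ^+ 2 / de ^+ 2.
  move=> xd xL; pose t := de ^+ 2 / (4 * L ^+ 2).
  have t0 : 0 <= t by rewrite divr_ge0 ?sqr_ge0// mulr_ge0// sqr_ge0.
  have cosle : cos (L^-1 * x) ^+ 2 <= 1 - t.
    rewrite cos2sin2 lerD2l lerN2.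
    have a1 : `|L^-1 * x| <= 1.
      by rewrite normrM gtr0_norm ?invr_gt0// ler_pdivrMl// mulr1.
    have := norm_sin_ge (le_trans a1 (pihalf_ge1 R)) => hs.
    have -> : t = (de / L / 2) ^+ 2 by rewrite /t; field; rewrite gt_eqF.
    apply: sq_ge; first by rewrite !divr_ge0// ltW.
    apply: le_trans hs; rewrite ler_wpM2r// normrM gtr0_norm ?invr_gt0// mulrC.
    by rewrite ler_wpM2l// invr_ge0 ltW.
  have /andP[c0 c1] := cs (L^-1 * x).
  have := dual_bernoulli k c0 t0 cosle.
  have ktE : k%:R * t = de ^+ 2 / (8 * h ^+ 2).
    by rewrite kE /t /L; field; rewrite mn0 hn0.
  rewrite -/(w x) ktE => hb.
  have d8 : 0 < de ^+ 2 / (8 * h ^+ 2) by rewrite divr_gt0 ?mulr_gt0 ?exprn_gt0.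
  have -> : 8 * h ^+ 2 / de ^+ 2 = (de ^+ 2 / (8 * h ^+ 2))^-1 by rewrite invf_div.
  rewrite -[leRHS]div1r ler_pdivlMr// mulrC; apply: le_trans hb.
  by rewrite ler_wpM2r ?lerDr//; case/andP: (w01 x).
have uM1 x : `|u x| <= M / (1 + x ^+ 2).
  rewrite ler_pdivlMr//; apply: le_trans (uM x); rewrite ler_wpM2l//.
  by rewrite expr2 ler_peMr ?(ltW (wpos x))// lerDl sqr_ge0.
have low x : - (tau / (1 + x ^+ 2)) <= u x * w x.
  have /andP[w0 w1] := w01 x.
  have [xd|/ltW dx] := leP `|x| de.
    apply: (@le_trans _ _ 0); first by rewrite oppr_le0 divr_ge0// ltW.
    by rewrite mulr_ge0//; have := near x xd; rewrite /c; lra.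
  have key : `|u x| * w x <= tau / (1 + x ^+ 2).
    have [xL|/ltW Lx] := leP `|x| L.
      apply: (@le_trans _ _ (M / (1 + x ^+ 2) * (8 * h ^+ 2 / de ^+ 2))).
        by rewrite ler_pM// away.
      rewrite mulrAC ler_wpM2r ?invr_ge0 ?(ltW (wpos x))//.
      by rewrite /tau ler_wpM2l ?(ltW M0)// lerDl divr_ge0 ?sqr_ge0.
    apply: (@le_trans _ _ `|u x|); first by rewrite ler_piMr.
    have w2 : 0 < (1 + x ^+ 2) ^+ 2 by rewrite exprn_gt0.
    apply: (@le_trans _ _ (M / (1 + x ^+ 2) ^+ 2)); first by rewrite ler_pdivlMr.
    rewrite expr2 invfM mulrA ler_wpM2r ?invr_ge0 ?(ltW (wpos x))//.
    rewrite /tau ler_wpM2l ?(ltW M0)//.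
    apply: (@le_trans _ _ (1 / L ^+ 2)).
      rewrite div1r lef_pV2 ?posrE ?exprn_gt0//.
      by apply: le_trans (sq_ge _ _ (ltW L0) Lx) _; rewrite lerDr.
    by rewrite lerDr divr_ge0 ?sqr_ge0// mulr_ge0// sqr_ge0.
  have := ler_norm (- (u x * w x)); rewrite normrN normrM (ger0_norm w0); lra.
have dG (s : R) (x : R) : is_derive x 1 (fun t => F t + s * atan t)
    (u x * w x + s * (1 + x ^+ 2)^-1).
  by apply: is_deriveD; apply: (@is_deriveZ _ _ _ (@atan R)).
have mono x y : x <= y -> F x + tau * atan x <= F y + tau * atan y.
  move=> xy; have [z _ hz] := mean_value xy (fun z _ => dG tau z).
  rewrite -subr_ge0 hz mulr_ge0 ?subr_ge0//.
  by have := low z; lra.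
have hh : - h <= h by lra.
have jump : c / 4 * (2 * h) <= (F h + tau * atan h) - (F (- h) + tau * atan (- h)).
  have [z zh hz] := mean_value hh (fun z _ => dG tau z).
  have nz : `|z| <= h by rewrite ler_norml.
  have e2h : h - - h = 2 * h by ring.
  rewrite hz e2h ler_wpM2r ?mulr_ge0 ?(ltW h0)//.
  have hu := near z (le_trans nz hde); have hw := peak z nz.
  have : (c / 2) * (1 / 2) <= u z * w z.
    by apply: ler_pM => //; rewrite divr_ge0// ltW.
  have : 0 <= tau * (1 + z ^+ 2)^-1 by rewrite mulr_ge0// invr_ge0 ltW.
  lra.
have hc0 : 0 < c * h / 8 by rewrite divr_gt0// mulr_gt0.
have [X HX] := lF _ hc0.
pose x := Num.max X h.
have [k0 k1] : `|F (- x) - 0| <= c * h / 8 /\ `|F x - 0| <= c * h / 8.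
  by apply: HX; rewrite le_max lexx.
have hx : h <= x by rewrite le_max lexx orbT.
have m2 := mono _ _ hx.
have m3 : F (- x) + tau * atan (- x) <= F (- h) + tau * atan (- h).
  by apply: mono; rewrite lerN2.
have at1 : tau * (atan x - atan (- x)) <= tau * pi.
  by rewrite ler_wpM2l//; have := atan_ltpi2 x; have := atan_gtNpi2 (- x); lra.
have t1 : M * (8 * h ^+ 2 / de ^+ 2) * pi <= c * h / 8.
  have e : M * (8 * h ^+ 2 / de ^+ 2) * pi = h * (8 * M * pi / de ^+ 2) * h.
    by field; rewrite gt_eqF.
  have b : h * (8 * M * pi / de ^+ 2) <= c / 8.
    have A0 : 0 < 8 * M * pi / de ^+ 2 by rewrite divr_gt0 ?mulr_gt0 ?exprn_gt0.
    have cancel_pi (p : R) : 0 < p -> c * de ^+ 2 / (64 * M * p) * (8 * M * p / de ^+ 2) = c / 8.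
      by move=> pp; field; rewrite !gt_eqF.
    by apply: le_trans (ler_wpM2r (ltW A0) hq) _; rewrite cancel_pi.
  by rewrite e [leRHS]mulrAC ler_wpM2r// ltW.
have t2 : M * (1 / L ^+ 2) * pi <= c * h / 16.
  have e : M * (1 / L ^+ 2) * pi = Q * (c * h / (16 * m%:R ^+ 2)).
    by rewrite /Q /L; field; rewrite mn0 hn0 gt_eqF.
  have ch : 0 <= c * h / (16 * m%:R ^+ 2).
    by rewrite divr_ge0 ?mulr_ge0 ?sqr_ge0// ltW.
  rewrite e; apply: le_trans (ler_wpM2r ch (ltW mQ)) _.
  have -> : m%:R * (c * h / (16 * m%:R ^+ 2)) = c * h / 16 * m%:R^-1 by field.
  by rewrite ler_piMr ?divr_ge0 ?mulr_ge0 ?(ltW h0) ?(ltW u0)// invf_le1// (lt_le_trans _ m1).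
have tauE : tau * pi = M * (8 * h ^+ 2 / de ^+ 2) * pi + M * (1 / L ^+ 2) * pi.
  by rewrite /tau; ring.
move: k0 k1; rewrite !subr0 !ler_norml => /andP[? ?] /andP[? ?].
lra.
Qed.

Lemma shifted_quadratic_decay (g : R -> R[i]) (y : R) :
  rapidly_decaying (fun x => normc (g x)) ->
  exists M, forall x, normc (g (x + y)) * (1 + x ^+ 2) ^+ 2 <= M.
Proof.
move=> dg; have [M hM] := rapidly_decaying_poly 2 dg (fun x => normc_ge0 (g x)).
exists ((2 + 2 * y ^+ 2) ^+ 2 * M) => x.
have C0 : 0 <= 2 + 2 * y ^+ 2 by rewrite addr_ge0// mulr_ge0// sqr_ge0.
have p (t : R) : 0 <= 1 + t ^+ 2 by rewrite addr_ge0// sqr_ge0.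
apply: (@le_trans _ _ ((2 + 2 * y ^+ 2) ^+ 2 * (normc (g (x + y)) * (1 + (x + y) ^+ 2) ^+ 2))).
  rewrite [leRHS]mulrCA -exprMn ler_wpM2l ?normc_ge0//.
  by rewrite lerXn2r ?nnegrE ?mulr_ge0 ?p// shift_weight.
by rewrite ler_wpM2l ?exprn_ge0.
Qed.

Lemma cos_as_e1 (et x : R) :
  (cos (et * x))%:C = 2^-1 * (e1 (et / (2 * pi) * x) + e1 (- (et / (2 * pi)) * x)) :> R[i].
Proof.
have pn : pi != 0 :> R by rewrite gt_eqF// pi_gt0.
have E (p t : R) : p != 0 -> 2 * p * (t / (2 * p) * x) = t * x by move=> ?; field.
have E' : 2 * pi * (- (et / (2 * pi)) * x) = - (et * x) by rewrite mulNr mulrN E.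
have half : 2^-1 = (2^-1 : R)%:C :> R[i] by rewrite fmorphV rmorph_nat.
rewrite /e1 E// E' /cis cosN sinN half.
by apply/eqP; rewrite eq_complex /=; apply/andP; split; apply/eqP; field.
Qed.

(** Multiplying by a cosine averages two translates of the transform. *)
Lemma zero_transform_cos (k : R -> R[i]) (et : R) (n : nat) :
  (forall om, has_integral (fun x => k x * e1 (- om * x)) 0) ->
  forall om, has_integral (fun x => k x * ((cos (et * x)) ^+ n)%:C * e1 (- om * x)) 0.
Proof.
move=> hk; elim: n => [|n IH] om.
  by apply: has_integral_ext (hk om) => x; rewrite expr0 mulr1.
pose l := et / (2 * pi).
have := has_integral_scale (2^-1) (has_integralD (IH (om - l)) (IH (om + l))).
rewrite addr0 mulr0; apply: has_integral_ext => x.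
have -> : - (om - l) * x = l * x + - om * x by ring.
have -> : - (om + l) * x = - l * x + - om * x by ring.
by rewrite !e1D exprS rmorphM /= cos_as_e1 -/l; ring.
Qed.

(** The vanishing of the integrals against all characters passes to
    trigonometric polynomials, in particular to powers of slow cosines, which
    read off the value of the function at a point by [peak_test]. *)
Lemma transform_injective (g dg : R -> R[i]) : has_cderiv g dg ->
  rapidly_decaying (fun x => normc (g x)) ->
  (forall om, has_integral (fun x => g x * e1 (- om * x)) 0) -> forall y, g y = 0.
Proof.
move=> dgP rd zero y.
have [M hM] := shifted_quadratic_decay y rd.
(* makes the value at 0 of the real part equal to the squared modulus of [g y] *)
pose c := (g y)^*.
pose k x := c * g (x + y).
have hk om : has_integral (fun x => k x * e1 (- om * x)) 0.
  have := has_integral_scale (c * e1 (om * y)) (has_integral_shift y (zero om)).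
  rewrite mulr0; apply: has_integral_ext => x; rewrite /k.
  have -> : - om * x = om * y + - om * (x + y) by ring.
  by rewrite e1D; ring.
have dk : has_cderiv k (fun x => 0 * g (x + y) + c * dg (x + y)).
  exact: has_cderivM (has_cderiv_cst c) (has_cderiv_shift y dgP).
have [cr _] := has_cderiv_continuous dk.
have test (et : R) (n : nat) :
    has_rintegral (fun x => complex.Re (k x) * (cos (et * x) ^+ 2) ^+ n) 0.
  have [h _] := zero_transform_cos et (2 * n) hk 0.
  apply: has_rintegral_ext h => x.
  rewrite oppr0 mul0r e10 mulr1 exprM; case: (k x) => a b /=.
  by rewrite mulr0 subr0.
have bnd x : `|complex.Re (k x)| * (1 + x ^+ 2) ^+ 2 <= normc c * M.
  have p : 0 <= (1 + x ^+ 2) ^+ 2 by rewrite exprn_ge0// addr_ge0// sqr_ge0.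
  apply: le_trans (ler_wpM2r p (normc_Re_le _)) _.
  by rewrite /k normcM -mulrA ler_wpM2l ?normc_ge0.
have := peak_test cr bnd test; rewrite /k add0r.
have -> : complex.Re (c * g y) = normc (g y) ^+ 2.
  by rewrite normc_sqr /c; case: (g y) => a b /=; ring.
rewrite le_eqVlt ltNge sqr_ge0 orbF sqrf_eq0 normc_eq0 => /eqP //.
Qed.

End Injectivity.

(** * From a configuration to vertical lines *)

Section Reduction.
Variable R : realType.

(** Up to a factor, the coordinate transverse to the direction [v]. *)
Definition cross (v q : R * R) : R := v.1 * q.2 - v.2 * q.1.

Lemma cross_line (a v q : R * R) : line a v q -> cross v q = cross v a.
Proof. by move=> [s ->]; rewrite /cross /=; ring. Qed.

Lemma line_subset (a b v : R * R) : v <> (0, 0) -> cross v a = cross v b ->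
  line a v `<=` line b v.
Proof.
move=> v0 e q [s ->]; rewrite /cross in e.
case: v v0 e => v1 v2 /= v0 e.
have [v1z|v1nz] := eqVneq v1 0.
  have v2nz : v2 != 0 by apply/eqP => v2z; apply: v0; rewrite v1z v2z.
  exists (s + (a.2 - b.2) / v2); rewrite v1z /= !mulr0 !addr0.
  move: e; rewrite v1z !mul0r !sub0r => /eqP; rewrite eqr_opp => /eqP /(mulfI v2nz) ->.
  by congr pair; rewrite mulrDl divfK//; ring.
exists (s + (a.1 - b.1) / v1) => /=; congr pair.
  by rewrite mulrDl divfK//; ring.
apply: (mulfI v1nz); rewrite !mulrDr.
have -> : v1 * ((s + (a.1 - b.1) / v1) * v2) = v1 * (s * v2) + (a.1 - b.1) * v2.
  by field.
have -> : v1 * a.2 = v1 * b.2 - v2 * b.1 + v2 * a.1 by rewrite -e; ring.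
ring.
Qed.

(** Distinct parallel lines have distinct values of [cross v], and since the
    counts on the two lines add up to 4 no point lies off them. *)
Lemma configuration_split (n m : nat) (p : 'I_4 -> R * R) :
  is_configuration n m p -> exists (v : R * R) (la lb : R),
  [/\ v <> (0, 0), la != lb, (forall j, cross v (p j) = la \/ cross v (p j) = lb)
    & #|[pred j | cross v (p j) == la]| = n].
Proof.
move=> [_ cI [a [b [v [v0 lab cn cm]]]]].
have labne : cross v a != cross v b.
  apply/eqP => e; apply: lab; apply/seteqP; split; exact: line_subset.
exists v, (cross v a), (cross v b).
pose A := [pred j | cross v (p j) == cross v a].
pose B := [pred j | cross v (p j) == cross v b].
have nA : (n <= #|A|)%N.
  rewrite -cn; apply: subset_leq_card; apply/fintype.subsetP => j.
  by rewrite !inE => /cross_line ->.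
have mB : (m <= #|B|)%N.
  rewrite -cm; apply: subset_leq_card; apply/fintype.subsetP => j.
  by rewrite !inE => /cross_line ->.
have AB0 : #|predI A B| = 0%N.
  apply: eq_card0 => j; rewrite !inE; apply/negP => /andP[/eqP e /eqP e'].
  by move: labne; rewrite -e -e' eqxx.
have cUI := cardUI A B; rewrite AB0 addn0 in cUI.
have leU : (#|predU A B| <= 4)%N by rewrite (leq_trans (max_card _))// card_ord.
rewrite card_ord in cI.
have cA : #|A| = n.
  apply/eqP; rewrite eqn_leq nA andbT -(leq_add2r #|B|) -cUI.
  by apply: leq_trans leU _; apply: leq_trans (leq_add (leqnn n) mB); rewrite -cI.
have cU : #|predU A B| = 4%N.
  by apply/eqP; rewrite eqn_leq leU cUI; apply: leq_trans (leq_add nA mB); rewrite -cI.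
split => // j.
have : j \in predU A B.
  have /eqP := cardC (predU A B); rewrite card_ord cU -[X in _ == X]addn0 eqn_add2l.
  by move=> /eqP/card0_eq/(_ j); rewrite !inE => /negbFE.
by rewrite !inE => /orP[] /eqP; [left|right].
Qed.

(** A ball on which a continuous function does not vanish has positive measure. *)
Lemma ae_zero_everywhere (G dG : R -> R[i]) : has_cderiv G dG ->
  {ae (@lebesgue_measure R), forall x : R, G x = 0} -> forall x, G x = 0.
Proof.
move=> d ae x; have [cr ci] := has_cderiv_continuous d.
have cN := continuous_normc cr ci.
apply/eqP; rewrite -normc_eq0; apply/negPn/negP => nz.
have g0 : 0 < normc (G x) by rewrite lt_def nz normc_ge0.
have /cvgrPdist_lt /(_ _ g0) /nbhs_ballP [e /= e0 he] := cN x.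
have sub : ball x e `<=` ~` [set y | G y = 0].
  move=> y /he /=; apply: contraPnot => ->.
  by rewrite normc0 subr0 ger0_norm ?normc_ge0// ltxx.
have ae' : (@lebesgue_measure R).-negligible (~` [set y | G y = 0]) := ae.
have := @negligibleS _ _ _ (@lebesgue_measure R) _ _ sub ae'.
rewrite negligibleP; last by rewrite ball_itv; exact: measurable_itv.
move=> /(etrans (esym (lebesgue_measure_ball x (ltW e0)))) -[] /eqP.
by rewrite mulrn_eq0 /= gt_eqF.
Qed.

Lemma has_cderiv_sum (n : nat) (H dH : 'I_n -> R -> R[i]) :
  (forall i, has_cderiv (H i) (dH i)) ->
  has_cderiv (fun x => \sum_(i < n) H i x) (fun x => \sum_(i < n) dH i x).
Proof.
elim: n H dH => [|n IH] H dH hH.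
  by apply: has_cderiv_ext (has_cderiv_cst 0) => x; rewrite big_ord0.
apply: has_cderiv_ext (has_cderivD (IH _ _ (fun i => hH (widen_ord (leqnSn n) i)))
  (hH ord_max)) => x; by rewrite big_ord_recr.
Qed.

Lemma is_derive_lin (a x : R) : is_derive x 1 (fun y => a * y) a.
Proof.
by rewrite -[X in is_derive _ _ _ X]mulr1; apply: (@is_deriveZ _ _ _ (@id R) a).
Qed.

Lemma lipschitz_continuous (u : R -> R) (C : R) :
  (forall x y, `|u x - u y| <= C * `|x - y|) -> continuous u.
Proof.
move=> hu x; apply/cvgrPdist_lt => e e0.
have C0 : 0 < `|C| + 1 by rewrite ltr_wpDl.
apply/nbhs_ballP; exists (e / (`|C| + 1)) => /=; first by rewrite divr_gt0.
move=> y; rewrite /ball /= ltr_pdivlMr// => xy.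
apply: le_lt_trans (hu x y) _; apply: le_lt_trans xy.
rewrite mulrC ler_wpM2l//; have := ler_norm C; lra.
Qed.

Variable f : R -> R[i].
Hypothesis hf : schwartz f.

Lemma schwartz_cderiv : exists df, has_cderiv f df.
Proof. by have [df _ d] := span_has_deriv hf (span_self f); exists df. Qed.

Lemma schwartz_decay : rapidly_decaying (fun x => normc (f x)).
Proof. exact: span_decay hf _ (span_self f). Qed.

(** The chirp shears lines of slope [2 * sg] to horizontal ones, and the Fourier
    transform makes these vertical; decay, continuity and non-vanishing,
    required in the vertical case, are preserved. *)
Lemma chirp_transform (sg : R) : exists G : R -> R[i],
  [/\ forall om, has_integral (chirped sg f om) (G om),
      continuous (fun om => normc (G om)),
      rapidly_decaying (fun om => normc (G om))
    & (forall om, G om = 0) -> forall x, f x = 0].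
Proof.
have sf := span_self f.
have /choice[G GP] := fun om => chirped_integral sg hf om sf.
exists G; split => //.
- have [C hC] := chirped_integral_lipschitz sg hf sf.
  have sub (a b : R[i]) : (complex.Re a - complex.Re b = complex.Re (a - b)) *
    (complex.Im a - complex.Im b = complex.Im (a - b)) by case: a b => [? ?] [? ?].
  apply: continuous_normc; apply: (@lipschitz_continuous _ C) => x y;
    apply: le_trans (hC _ _ _ _ (GP x) (GP y)).
    by rewrite sub normc_Re_le.
  by rewrite sub normc_Im_le.
- move=> K; have [M hM] := chirped_integral_decay sg hf K sf.
  by exists M => om; apply: hM.
move=> G0.
have [df d] := schwartz_cderiv.
have dx2 (x : R) : is_derive x 1 (fun x => sg * x ^+ 2) (sg * (2 * x)).
  have d1 : is_derive x 1 (fun x : R => x ^+ 2) (2 * x).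
    have := @is_deriveX R _ (@id R) 2 x 1 1 (is_derive_id _ _).
    by congr is_derive; rewrite /GRing.scale /= expr1 mulr1.
  exact: (@is_deriveZ _ _ _ (fun x : R => x ^+ 2) sg).
have z : forall y, f y * e1 (sg * y ^+ 2) = 0.
  apply: (transform_injective (has_cderivM d (has_cderiv_e1 dx2))).
    by move=> K; have [M hM] := schwartz_decay K; exists M => x; rewrite normcM normc_e1 mulr1.
  move=> om; have := GP om; rewrite G0; apply: has_integral_ext => x.
  by rewrite /chirped e1D mulrA.
by move=> x; apply/eqP; have /eqP := z x; rewrite mulf_eq0 (negbTE (e1_neq0 _)) orbF.
Qed.

(** When [v] is not vertical, writing [xi j = b j + 2 * sg * t j] and integrating the
    relation against [e1 (sg * x ^+ 2 - om * x)] gives a relation for the transform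
    [G], with translates by [- b j] and frequencies [t j]. *)
Lemma two_lines_independent (t xi : 'I_4 -> R) (v : R * R) (la lb : R)
    (d : 'I_4 -> R[i]) :
  injective (fun j => (t j, xi j)) -> v <> (0, 0) -> la != lb ->
  (forall j, cross v (t j, xi j) = la \/ cross v (t j, xi j) = lb) ->
  #|[pred j | cross v (t j, xi j) == la]| = 1%N \/
  #|[pred j | cross v (t j, xi j) == la]| = 2%N ->
  (exists j, d j != 0) ->
  (forall x, \sum_(j < 4) d j * f (x + t j) * e1 (xi j * x) = 0) ->
  forall x, f x = 0.
Proof.
move=> inj v0 lab onl card dn0 rel.
have [df dfP] := schwartz_cderiv; have [cr ci] := has_cderiv_continuous dfP.
have cardE (mu : R) (al : 'I_4 -> R) : mu != 0 ->
    (forall j, al j = mu * cross v (t j, xi j)) ->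
    #|finset (fun j => al j == mu * la)| = #|[pred j | cross v (t j, xi j) == la]|.
  move=> mu0 alE; apply: eq_card => j; rewrite !inE alE.
  by apply/eqP/eqP => [/(mulfI mu0)|->].
have muab (mu : R) : mu != 0 -> mu * la != mu * lb.
  by move=> mu0; apply: contra lab => /eqP /(mulfI mu0) ->.
have onl' (mu : R) (al : 'I_4 -> R) : (forall j, al j = mu * cross v (t j, xi j)) ->
    forall j, al j = mu * la \/ al j = mu * lb.
  by move=> alE j; rewrite alE; case: (onl j) => ->; [left|right].
have [v1z|v1nz] := eqVneq v.1 0.
  have v2nz : v.2 != 0.
    by apply/eqP => v2z; apply: v0; rewrite [v]surjective_pairing v1z v2z.
  have mu0 : - v.2^-1 != 0 by rewrite oppr_eq0 invr_eq0.
  have tE j : t j = - v.2^-1 * cross v (t j, xi j).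
    by rewrite /cross v1z /=; field.
  apply: (@vertical_lines_independent R f (- v.2^-1 * la) (- v.2^-1 * lb) t xi d) => //.
  - exact: continuous_normc.
  - exact: schwartz_decay.
  - exact: muab.
  - exact: onl'.
  - by rewrite (cardE _ _ mu0 tE).
pose s := v.2 / v.1; pose sg := s / 2.
pose b j := xi j - s * t j.
have mu0 : - v.1^-1 != 0 by rewrite oppr_eq0 invr_eq0.
have bE j : - b j = - v.1^-1 * cross v (t j, xi j).
  by rewrite /b /s /cross /=; field.
have [G [GP cG dG Gz]] := chirp_transform sg.
apply: Gz.
pose d' j := d j * e1 (- (sg * t j ^+ 2) - b j * t j).
apply: (@vertical_lines_independent R G (- v.1^-1 * la) (- v.1^-1 * lb)
  (fun j => - b j) t d') => //.
- exact: muab.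
- exact: onl'.
- move=> j k [/oppr_inj bjk tjk]; apply: inj; congr pair => //.
  by move: bjk; rewrite /b tjk => /addIr.
- by rewrite (cardE _ _ mu0 bE).
- by have [j dj] := dn0; exists j; rewrite /d' mulf_neq0// e1_neq0.
move=> om.
pose H (j : 'I_4) x := d' j * e1 (t j * om) * chirped sg f (om + - b j) (x + t j).
have hH j : has_integral (H j) (d' j * G (om + - b j) * e1 (t j * om)).
  rewrite mulrAC; apply: has_integral_scale.
  exact: (has_integral_shift (t j) (GP (om + - b j))).
have := has_integral_sum hH => hsum.
apply: (has_integral_unique hsum).
apply: has_integral_ext (has_integral0 R) => x.
have -> : \sum_(j < 4) H j x =
    e1 (sg * x ^+ 2 + - om * x) * (\sum_(j < 4) d j * f (x + t j) * e1 (xi j * x)).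
  rewrite mulr_sumr; apply: eq_bigr => j _.
  rewrite /H /d' /chirped.
  have -> : d j * e1 (- (sg * t j ^+ 2) - b j * t j) * e1 (t j * om) *
      (f (x + t j) * e1 (sg * (x + t j) ^+ 2 + - (om + - b j) * (x + t j))) =
    d j * f (x + t j) * (e1 (- (sg * t j ^+ 2) - b j * t j) * e1 (t j * om) *
      e1 (sg * (x + t j) ^+ 2 + - (om + - b j) * (x + t j))) by ring.
  have -> : e1 (sg * x ^+ 2 + - om * x) * (d j * f (x + t j) * e1 (xi j * x)) =
    d j * f (x + t j) * (e1 (sg * x ^+ 2 + - om * x) * e1 (xi j * x)) by ring.
  rewrite -!e1D; congr (_ * e1 _).
  have -> : xi j = b j + 2 * sg * t j by rewrite /b /sg; field.
  ring.
by rewrite rel mulr0.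
Qed.

End Reduction.

Theorem theorem1p3 (R : realType) (t xi : 'I_4 -> R)
    (hdistinct : injective (fun j => (t j, xi j)))
    (hconf : is_configuration 1 3 (fun j => (t j, xi j)) \/
             is_configuration 2 2 (fun j => (t j, xi j)))
    (f : R -> R[i]) (hf : schwartz f) (hf0 : ~ (forall x, f x = 0)) :
  ~ exists d : 'I_4 -> R[i],
      (exists j, d j <> 0) /\
      {ae (@lebesgue_measure R), forall x : R,
        \sum_(j < 4) d j * f (x + t j) * cis (2 * pi * xi j * x) = 0}.
Proof.
move=> [d [[j0 dj0] ae]]; apply: hf0.
have dn0 : exists j, d j != 0 by exists j0; apply/eqP.
have [df dfP] := schwartz_cderiv hf.
pose term j x := d j * f (x + t j) * e1 (xi j * x).
have dterm j := has_cderivM (has_cderivM (has_cderiv_cst (d j))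
  (has_cderiv_shift (t j) dfP)) (has_cderiv_e1 (is_derive_lin (xi j))).
have relE x : \sum_(j < 4) d j * f (x + t j) * cis (2 * pi * xi j * x) =
    \sum_(j < 4) term j x.
  by apply: eq_bigr => j _; rewrite /term /e1 mulrA.
have dsum := has_cderiv_ext (fun x => esym (relE x)) (fun=> erefl) (has_cderiv_sum dterm).
have rel x : \sum_(j < 4) term j x = 0.
  by rewrite -relE; exact: (ae_zero_everywhere dsum ae x).
have [v [la [lb [v0 lab onl card]]]] : exists (v : R * R) (la lb : R),
  [/\ v <> (0, 0), la != lb,
    (forall j, cross v (t j, xi j) = la \/ cross v (t j, xi j) = lb)
  & #|[pred j | cross v (t j, xi j) == la]| = 1%N \/
    #|[pred j | cross v (t j, xi j) == la]| = 2%N].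
  case: hconf => /configuration_split [v [la [lb [v0 lab onl card]]]];
    by exists v, la, lb; split => //; first [by left|by right].
exact: (two_lines_independent hf hdistinct v0 lab onl card dn0 rel).
Qed.
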